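(* Let $f\in C(\mathbb{R}^4)$, $f=f(r,\tau,u,t)$, be bounded and $\kappa$-Lipschitz continuous, $1$-periodic in $r$ and in $\tau$, and non-increasing in $u$. For $(u_0,t_0)\in\mathbb{R}^2$ let $\bar f(u_0,t_0)\in\mathbb{R}$ be the constant such that, for every $c\in\mathbb{R}$ and $t>0$, $\lim_{\varepsilon\to0}u^\varepsilon(t;c,u_0,t_0)=c+\bar f(u_0,t_0)t$, where $u^\varepsilon(\cdot;c,u_0,t_0)$ solves $\dot u^\varepsilon=f(u^\varepsilon/\varepsilon,t/\varepsilon,u_0,t_0)$, $u^\varepsilon(0)=c$. Then: (i) for all $t_1,t_2>0$ and $u_1,u_2\in\mathbb{R}$, \[|\bar f(u_1,t_1)-\bar f(u_2,t_2)|\leq \frac{2}{\Big\lfloor \frac{1}{\kappa}W\Big(\frac{1}{|u_1-u_2|+|t_1-t_2|}\Big)\Big\rfloor};\] (ii) for every $c\in\mathbb{R}$ there is a unique solution $\overline{u}(t;c)$ of $\dot{\overline u}=\bar f(\overline u,t)$, $t>0$, $\overline u(0)=c$; (iii) there is a constant $C>0$ depending only on $\|f\|_{W^{1,\infty}(\mathbb{R}^4)}$ such that, letting $u^\varepsilon(t;c)$ be the solution of $\dot u^\varepsilon=f(u^\varepsilon/\varepsilon,t/\varepsilon,u^\varepsilon,t)$, $u^\varepsilon(0)=c$, for $\varepsilon\in(0,1)$ and $c\in\mathbb{R}$: \[|u^\varepsilon(t;c)-\overline u(t;c)|\leq \frac{Ct}{|\log\varepsilon|}\ \text{ for } t>\varepsilon|\log\varepsilon|,\qquad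 |u^\varepsilon(t;c)-\overline u(t;c)|\leq \min\{C\varepsilon,2\|f\|_\infty t\}\ \text{ for } t\in[0,\varepsilon|\log\varepsilon|].\]
   Context: $W$ denotes the inverse of the map $x\mapsto xe^x$ on $[0,\infty)$ (Lambert W function); $\lfloor x\rfloor$ is the greatest integer $\le x$. When the floor in the denominator is $0$ (or $u_1=u_2,t_1=t_2$ trivially), the bound in (i) is understood as $+\infty$ resp. $0$ as appropriate. The existence of $\bar f(u_0,t_0)$ holds since for fixed $(u_0,t_0)$ the function $(r,\tau)\mapsto f(r,\tau,u_0,t_0)$ is $\mathbb{Z}^2$-periodic and Lipschitz. *)

(* Defs.v *)
From Stdlib Require Import Reals.
From Coquelicot Require Import Coquelicot.
Open Scope R_scope.

(* Lambert W on [0,oo): W y = sup {x >= 0 | x e^x <= y}, which is the unique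
   x >= 0 with x e^x = y, since x |-> x e^x is an increasing bijection of [0,oo). *)
Definition LambertW (y : R) : R :=
  real (Lub_Rbar (fun x => 0 <= x /\ x * exp x <= y)).

Definition Rfloor (x : R) : R := IZR (Int_part x).

Definition dist4 (r τ u t r' τ' u' t' : R) : R :=
  sqrt ((r - r')^2 + (τ - τ')^2 + (u - u')^2 + (t - t')^2).

(* ||f||_{L^oo(R^4)} (f continuous, so sup = ess sup) *)
Definition sup_norm4 (f : R -> R -> R -> R -> R) : R :=
  real (Lub_Rbar (fun y => exists r τ u t, y = Rabs (f r τ u t))).

(* ||grad f||_{L^oo(R^4)} for Lipschitz f: the best Euclidean Lipschitz constant *)
Definition lip_norm4 (f : R -> R -> R -> R -> R) : R :=
  real (Lub_Rbar (fun y => exists r τ u t r' τ' u' t',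
     dist4 r τ u t r' τ' u' t' <> 0 /\
     y = Rabs (f r τ u t - f r' τ' u' t') / dist4 r τ u t r' τ' u' t')).

Definition W1inf_norm4 (f : R -> R -> R -> R -> R) : R :=
  sup_norm4 f + lip_norm4 f.

Definition ode_sol (g : R -> R -> R) (c : R) (u : R -> R) : Prop :=
  u 0 = c /\ filterlim u (at_right 0) (locally c) /\
  (forall t, 0 < t -> is_derive u t (g (u t) t)).

(* Main.v *)
(* Let W solve the frozen equation W' = f(W, s, u0, t0), W(0) = 0. Comparison with integer
   translates shows that W(n + s) - W(n) - W(s) is bounded by 1, so W(s) = fbar s + O(1), and
   fbar is the rotation number of W. If the frozen parameters of W1, W2 differ by d and
   d κ s0 exp(κ s0) <= 1, Gronwall and x e^x >= e^x - 1 give W2 <= W1 + 1 after time s0; as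
   integer translates of solutions are solutions, W2(k s0) <= W1(k s0) + k for all k, whence
   |fbar1 - fbar2| <= 1/s0. This is (i), with constant 1 in place of 2.
   Since fbar is bounded, uniformly continuous and non-increasing in u, delayed (Tonelli)
   approximations of the effective equation form a Cauchy sequence, and solutions are unique.
   For (iii) use the fast time s = t/eps and cut it into steps of length s0 = η |log eps|, η
   small. On one step u^eps/eps follows a frozen solution, hence fbar s, up to O(1), while
   the modulus of continuity 1/s0 of fbar over the step costs another O(1). Monotonicity
   of fbar in u prevents amplification of earlier errors, so after t/(eps s0) + 1 steps the
   error in u^eps is O(t/|log eps| + eps). *)
Require Import Defs.
From Stdlib Require Import Reals ZArith Lra Lia.
From Coquelicot Require Import Coquelicot.
Open Scope R_scope.

(** * Pointwise continuity and a one-sided Gronwall inequality *)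

Lemma continuous_lt_ball (E : R -> R) (t e : R) :
  continuous E t -> 0 < e -> exists d, 0 < d /\ forall s, Rabs (s - t) < d -> Rabs (E s - E t) < e.
Proof.
intros HE He.
destruct (proj1 (filterlim_locally E (E t)) HE (mkposreal e He)) as [d Hd].
exists d; split; [apply cond_pos|].
intros s Hs; exact (Hd s Hs).
Qed.

Lemma continuous_of_ball (E : R -> R) (t : R) :
  (forall e, 0 < e -> exists d, 0 < d /\ forall s, Rabs (s - t) < d -> Rabs (E s - E t) < e) ->
  continuous E t.
Proof.
intros H; apply filterlim_locally; intros e.
destruct (H e (cond_pos e)) as [d [Hd H']].
exists (mkposreal d Hd); intros s Hs; exact (H' s Hs).
Qed.

(** After the last time at which [E <= K], the function exceeds [K] and so cannot increase, by the
    mean value theorem. The derivative is controlled only above the level and never at [a], which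
    suits equations posed for [t > 0]. *)
Lemma barrier (E : R -> R) (a b K : R) :
  a <= b ->
  (forall t, a <= t <= b -> continuous E t) ->
  (forall t, a < t <= b -> K < E t -> exists l : R, is_derive E t l /\ l <= 0) ->
  E a <= K -> E b <= K.
Proof.
intros Hab Hc Hd Ha.
destruct (Rle_lt_dec (E b) K) as [|Hb]; [assumption|exfalso].
destruct (completeness (fun t => a <= t <= b /\ E t <= K)) as [s [Hub Hlub]].
{ exists b; intros x [Hx _]; lra. }
{ exists a; lra. }
assert (Has : a <= s) by (apply Hub; lra).
assert (Hsb : s <= b) by (apply Hlub; intros x [Hx _]; lra).
assert (HsK : E s <= K).
{ destruct (Rle_lt_dec (E s) K) as [|Hs]; [assumption|exfalso].
  destruct (continuous_lt_ball E s (E s - K) (Hc s (conj Has Hsb))) as [d [Hd0 Hball]]; [lra|].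
  assert (s <= s - d); [|lra].
  apply Hlub; intros x [Hx HxK].
  destruct (Rle_lt_dec x (s - d)) as [|Hxd]; [assumption|exfalso].
  assert (x <= s) by (apply Hub; split; assumption).
  assert (Hb' : Rabs (E x - E s) < E s - K) by (apply Hball; apply Rabs_def1; lra).
  apply Rabs_def2 in Hb'; lra. }
assert (Hsb' : s < b) by (destruct Hsb as [|Heq]; [assumption|rewrite Heq in HsK; lra]).
assert (Habove : forall t, s < t <= b -> K < E t).
{ intros t Ht; destruct (Rle_lt_dec (E t) K) as [HK|]; [|assumption].
  assert (t <= s) by (apply Hub; split; [lra|assumption]); lra. }
(* The intermediate point may be the endpoint [s], where nothing is known about the derivative;
   capping it at 0 keeps the sign there too. *)
destruct (MVT_gen E s b (fun x => Rmin (Derive E x) 0)) as [x [_ Hx]].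
- rewrite Rmin_left, Rmax_right by lra; intros x Hx.
  destruct (Hd x) as [l [Hl Hl0]]; [lra|apply Habove; lra|].
  rewrite (is_derive_unique _ _ _ Hl), Rmin_left by assumption; assumption.
- rewrite Rmin_left, Rmax_right by lra; intros x Hx.
  apply continuity_pt_filterlim, Hc; lra.
- assert (Rmin (Derive E x) 0 <= 0) by apply Rmin_r; nra.
Qed.

(** The integrating factor turns the claim into [barrier] at level [A] for
    [E t = D t exp (- L (t - a)) - δ (t - a)]: since [A >= 0], [E t > A] forces [D t > 0], where the
    differential inequality is available. *)
Lemma one_sided_gronwall (D : R -> R) (a b A L δ : R) :
  a <= b -> 0 <= A -> 0 <= L -> 0 <= δ ->
  (forall t, a <= t <= b -> continuous D t) ->
  (forall t, a < t <= b -> 0 < D t -> exists l : R, is_derive D t l /\ l <= L * D t + δ) ->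
  D a <= A -> D b <= (A + δ * (b - a)) * exp (L * (b - a)).
Proof.
intros Hab HA HL Hδ Hc Hd Ha.
set (E := fun t => D t * exp (- L * (t - a)) - δ * (t - a)).
assert (HE : E b <= A).
{ apply (barrier E a b A Hab).
  - intros t Ht; unfold E.
    apply (continuous_minus (fun t => D t * exp (- L * (t - a))) (fun t => δ * (t - a))).
    + apply (continuous_mult D (fun t => exp (- L * (t - a)))); [apply Hc, Ht|].
      apply (ex_derive_continuous (fun t => exp (- L * (t - a)))); auto_derive; trivial.
    + apply (ex_derive_continuous (fun t => δ * (t - a))); auto_derive; trivial.
  - intros t Ht HAE.
    assert (Hpos : 0 < exp (- L * (t - a))) by apply exp_pos.
    assert (0 <= δ * (t - a)) by (apply Rmult_le_pos; lra).
    assert (HD : 0 < D t).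
    { unfold E in HAE; destruct (Rlt_le_dec 0 (D t)) as [|HD]; [assumption|nra]. }
    destruct (Hd t Ht HD) as [l [Hl Hle]].
    exists (l * exp (- L * (t - a)) + D t * (- L * exp (- L * (t - a))) - δ); split.
    + apply (is_derive_minus (fun t => D t * exp (- L * (t - a))) (fun t => δ * (t - a))).
      * apply (is_derive_mult D (fun t => exp (- L * (t - a)))); [exact Hl| |exact Rmult_comm].
        auto_derive; [trivial|unfold Rminus; ring].
      * auto_derive; [trivial|ring].
    + assert (exp (- L * (t - a)) <= 1).
      { rewrite <- exp_0; destruct (Rle_lt_or_eq_dec 0 (L * (t - a))) as [Hlt|Heq].
        - apply Rmult_le_pos; lra.
        - apply Rlt_le, exp_increasing; lra.
        - right; f_equal; lra. }
      nra.
  - unfold E; rewrite Rminus_diag, !Rmult_0_r, exp_0; lra. }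
unfold E in HE.
assert (Hinv : exp (- L * (b - a)) * exp (L * (b - a)) = 1).
{ rewrite <- exp_plus, <- exp_0; f_equal; ring. }
assert (0 < exp (L * (b - a))) by apply exp_pos.
replace (D b) with ((D b * exp (- L * (b - a))) * exp (L * (b - a))).
- apply Rmult_le_compat_r; lra.
- rewrite Rmult_assoc, Hinv; ring.
Qed.

(** * Global solutions by delayed approximation under a one-sided Lipschitz condition *)

Definition joint_ucont (g : R -> R -> R) : Prop :=
  forall e, 0 < e -> exists d, 0 < d /\
    forall x y t s, Rabs (x - y) < d -> Rabs (t - s) < d -> Rabs (g x t - g y s) < e.

(** Continuity is asked at every real time, negative ones included, so that integrals and delayed
    arguments carry no side conditions. *)
Definition global_sol (g : R -> R -> R) (c : R) (u : R -> R) : Prop :=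
  u 0 = c /\ (forall t, continuous u t) /\
  (forall t, 0 < t -> is_derive u t (g (u t) t)).

Lemma continuous_along (g : R -> R -> R) (u : R -> R) (h t : R) :
  joint_ucont g -> (forall s, continuous u s) ->
  continuous (fun s => g (u (s - h)) s) t.
Proof.
intros Hg Hu; apply continuous_of_ball; intros e He.
destruct (Hg e He) as [d [Hd H]].
destruct (continuous_lt_ball u (t - h) d (Hu _) Hd) as [d' [Hd' H']].
exists (Rmin d d'); split; [apply Rmin_pos; assumption|].
intros s Hs; apply H.
- apply H'; replace (s - h - (t - h)) with (s - t) by ring.
  eapply Rlt_le_trans; [exact Hs|apply Rmin_r].
- eapply Rlt_le_trans; [exact Hs|apply Rmin_l].
Qed.

Lemma ex_RInt_along (g : R -> R -> R) (u : R -> R) (h a b : R) :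
  joint_ucont g -> (forall s, continuous u s) ->
  ex_RInt (fun s => g (u (s - h)) s) a b.
Proof.
intros Hg Hu; apply (ex_RInt_continuous (V := R_CompleteNormedModule)).
intros z _; apply continuous_along; assumption.
Qed.

Lemma abs_RInt_le (F : R -> R) (a b M : R) :
  ex_RInt F a b -> (forall s, Rmin a b <= s <= Rmax a b -> Rabs (F s) <= M) ->
  Rabs (RInt F a b) <= M * Rabs (b - a).
Proof.
intros HF HM.
destruct (Rle_dec a b) as [Hab|Hab].
- rewrite (Rabs_right (b - a)) by lra; rewrite Rmult_comm.
  rewrite Rmin_left, Rmax_right in HM by lra.
  apply abs_RInt_le_const; assumption.
- rewrite <- (opp_RInt_swap (V := R_CompleteNormedModule)) by (apply ex_RInt_swap, HF).
  rewrite Rmin_right, Rmax_left in HM by lra.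
  unfold opp; simpl; rewrite Rabs_Ropp, (Rabs_left (b - a)) by lra.
  replace (- (b - a)) with (a - b) by ring; rewrite Rmult_comm.
  apply abs_RInt_le_const; [lra|apply ex_RInt_swap, HF|assumption].
Qed.

(* Tonelli's scheme: iterating [n] times yields the solution of the delay equation
   [u' t = g (u (t - h)) t], [u = c] on the negative axis, up to time [n h]. *)
Fixpoint tonelli (g : R -> R -> R) (c h : R) (n : nat) : R -> R :=
  match n with
  | O => fun _ => c
  | S n => fun t => c + RInt (fun s => g (tonelli g c h n (s - h)) s) 0 (Rmax 0 t)
  end.

Lemma Rmax0_lip (x y : R) : Rabs (Rmax 0 x - Rmax 0 y) <= Rabs (x - y).
Proof.
unfold Rmax; destruct (Rle_dec 0 x), (Rle_dec 0 y);
  unfold Rabs; repeat destruct Rcase_abs; lra.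
Qed.

Lemma continuous_of_lip (u : R -> R) (M : R) :
  (forall x y, Rabs (u x - u y) <= M * Rabs (x - y)) -> forall t, continuous u t.
Proof.
intros HM t; apply continuous_of_ball; intros e He.
assert (H0 : 0 <= M).
{ specialize (HM 1 0); replace (1 - 0) with 1 in HM by ring; rewrite Rabs_R1 in HM.
  assert (0 <= Rabs (u 1 - u 0)) by apply Rabs_pos; lra. }
exists (e / (M + 1)); split; [apply Rdiv_lt_0_compat; lra|].
intros s Hs; apply Rle_lt_trans with (1 := HM s t).
assert (Hs' : (M + 1) * Rabs (s - t) < (M + 1) * (e / (M + 1))) by (apply Rmult_lt_compat_l; lra).
replace ((M + 1) * (e / (M + 1))) with e in Hs' by (field; lra).
assert (0 <= Rabs (s - t)) by apply Rabs_pos; nra.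
Qed.

Section Existence.
Context (g : R -> R -> R) (c M L : R).
Context (Hg : joint_ucont g) (HM : forall x t, Rabs (g x t) <= M) (HL : 0 <= L).
Context (Hos : forall x y t, y < x -> g x t - g y t <= L * (x - y)).

Lemma tonelli_lip (h : R) (n : nat) (x y : R) :
  Rabs (tonelli g c h n x - tonelli g c h n y) <= M * Rabs (x - y).
Proof using Hg HM.
assert (0 <= M) by (eapply Rle_trans; [apply Rabs_pos|apply (HM 0 0)]).
revert x y; induction n as [|n IH]; intros x y; simpl.
- rewrite Rminus_diag, Rabs_R0; apply Rmult_le_pos; [assumption|apply Rabs_pos].
- set (F := fun s => g (tonelli g c h n (s - h)) s).
  assert (HF : forall a b, ex_RInt F a b).
  { intros a b; apply ex_RInt_along; [exact Hg|exact (continuous_of_lip _ M IH)]. }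
  replace (c + RInt F 0 (Rmax 0 x) - (c + RInt F 0 (Rmax 0 y)))
    with (RInt F (Rmax 0 y) (Rmax 0 x)).
  + eapply Rle_trans; [apply (abs_RInt_le F _ _ M); [apply HF|intros; apply HM]|].
    apply Rmult_le_compat_l; [assumption|apply Rmax0_lip].
  + assert (HC := RInt_Chasles F 0 (Rmax 0 y) (Rmax 0 x) (HF _ _) (HF _ _)).
    unfold plus in HC; simpl in HC; lra.
Qed.

(** The right side looks back by [h], so each iteration settles one more interval of length [h]. *)
Lemma tonelli_stable (h : R) (n : nat) (t : R) :
  t <= INR n * h -> tonelli g c h (S n) t = tonelli g c h n t.
Proof using.
revert t; induction n as [|n IH]; intros t Ht.
- simpl in Ht; simpl; rewrite Rmax_left by lra.
  rewrite RInt_point; unfold zero; simpl; ring.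
- simpl tonelli at 2.
  change (tonelli g c h (S (S n)) t)
    with (c + RInt (fun s => g (tonelli g c h (S n) (s - h)) s) 0 (Rmax 0 t)).
  f_equal; apply RInt_ext; intros s Hs.
  rewrite Rmin_left, Rmax_right in Hs by apply Rmax_l.
  rewrite IH; [reflexivity|].
  rewrite S_INR in Ht.
  assert (s <= t); [|lra].
  revert Hs; unfold Rmax; destruct (Rle_dec 0 t); lra.
Qed.

Lemma tonelli_derive (h : R) (n : nat) (t : R) :
  0 < t -> is_derive (tonelli g c h (S n)) t (g (tonelli g c h n (t - h)) t).
Proof using Hg HM.
intros Ht.
set (F := fun s => g (tonelli g c h n (s - h)) s).
assert (Hc : forall s, continuous F s).
{ intros s; apply continuous_along; [exact Hg|exact (continuous_of_lip _ M (tonelli_lip h n))]. }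
apply (is_derive_ext_loc (fun t => c + RInt F 0 t)).
- exists (mkposreal t Ht); intros s Hs.
  change (Rabs (s - t) < t) in Hs; apply Rabs_def2 in Hs.
  simpl; rewrite (Rmax_right 0 s) by lra; reflexivity.
- replace (g (tonelli g c h n (t - h)) t) with (0 + F t) by (unfold F; ring).
  apply (is_derive_plus (fun _ => c) (fun t => RInt F 0 t)); [apply @is_derive_const|].
  apply (is_derive_RInt (V := R_CompleteNormedModule) F _ 0 t); [|apply Hc].
  apply filter_forall; intros x; apply (RInt_correct (V := R_CompleteNormedModule)).
  apply (ex_RInt_continuous (V := R_CompleteNormedModule)); intros; apply Hc.
Qed.

(** Delay [1 / (k + 1)] with [(k + 1)^2] iterations reaches time [k + 1]: the delay tends to 0 while
    the horizon tends to infinity. [U] iterates once more, so that its derivative refers to iterate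
    [iters k]. *)
Let step (k : nat) : R := / (INR k + 1).
Let iters (k : nat) : nat := (S k * S k)%nat.
Let U (k : nat) : R -> R := tonelli g c (step k) (S (iters k)).

Lemma step_pos (k : nat) : 0 < step k.
Proof using. apply Rinv_0_lt_compat; assert (H := pos_INR k); lra. Qed.

Lemma iters_step (k : nat) : INR (iters k) * step k = INR k + 1.
Proof using.
unfold iters, step; rewrite mult_INR, S_INR; field; assert (H := pos_INR k); lra.
Qed.

(** [tonelli_derive] expresses the derivative of [U k] through the previous iterate; up to the
    horizon that iterate is [U k] itself, which therefore solves the delay equation. *)
Lemma approx_delay (k : nat) (t : R) : t <= INR k + 1 ->
  U k (t - step k) = tonelli g c (step k) (iters k) (t - step k).
Proof using.
intros Ht; apply tonelli_stable; rewrite iters_step; assert (H := step_pos k); lra.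
Qed.

Lemma approx_delay_close (k : nat) (t d : R) : M * step k < d -> Rabs (U k (t - step k) - U k t) < d.
Proof using Hg HM.
intros H; eapply Rle_lt_trans; [apply tonelli_lip|].
replace (t - step k - t) with (- step k) by ring.
rewrite Rabs_Ropp, Rabs_right; [assumption|apply Rle_ge, Rlt_le, step_pos].
Qed.

Lemma step_small (d : R) : 0 < d -> exists N, forall k, (N <= k)%nat -> M * step k < d.
Proof using HM.
assert (HM0 : 0 <= M) by (eapply Rle_trans; [apply Rabs_pos|apply (HM 0 0)]).
intros Hd; destruct (INR_unbounded (M / d)) as [N HN]; exists N; intros k Hk.
apply le_INR in Hk; assert (Hp := pos_INR N).
apply Rmult_lt_reg_r with (INR k + 1); [lra|].
unfold step; rewrite Rmult_assoc, Rinv_l, Rmult_1_r by lra.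
apply Rmult_lt_compat_r with (r := d) in HN; [|assumption].
unfold Rdiv in HN; rewrite Rmult_assoc, Rinv_l, Rmult_1_r in HN by lra; nra.
Qed.

Lemma approx_nonpos (k : nat) (t : R) : t <= 0 -> U k t = c.
Proof using.
intros Ht; unfold U; simpl; rewrite Rmax_left by assumption.
rewrite RInt_point; unfold zero; simpl; ring.
Qed.

(** Undoing the delay costs [δ] in each right side, hence the forcing [2 * δ]; what remains is
    handled by the one-sided Lipschitz bound and Gronwall. *)
Lemma approx_close (k m : nat) (δ d t : R) :
  0 < δ -> (forall x y t s, Rabs (x - y) < d -> Rabs (t - s) < d -> Rabs (g x t - g y s) < δ) ->
  0 < d -> M * step k < d -> M * step m < d -> 0 <= t -> t <= INR k + 1 -> t <= INR m + 1 ->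
  U k t - U m t <= 2 * δ * t * exp (L * t).
Proof using Hg HM HL Hos.
intros Hδ Hd Hd0 Hk Hm Ht Hkt Hmt.
assert (HUc : forall n s, continuous (U n) s).
{ intros n; apply (continuous_of_lip _ M), tonelli_lip. }
replace (2 * δ * t * exp (L * t)) with ((0 + 2 * δ * (t - 0)) * exp (L * (t - 0)))
  by (rewrite Rminus_0_r; ring).
apply (one_sided_gronwall (fun t => U k t - U m t) 0 t 0 L (2 * δ)); try lra.
- intros s _; apply (continuous_minus (U k) (U m)); apply HUc.
- intros s Hs Hpos.
  exists (g (U k (s - step k)) s - g (U m (s - step m)) s); split.
  + rewrite !approx_delay by lra.
    apply (is_derive_minus (U k) (U m)); apply tonelli_derive; lra.
  + assert (H0 : Rabs (s - s) < d) by (rewrite Rminus_diag, Rabs_R0; assumption).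
    assert (H1 := Hd _ _ s s (approx_delay_close k s d Hk) H0).
    assert (H2 := Hd _ _ s s (approx_delay_close m s d Hm) H0).
    assert (H3 := Hos (U k s) (U m s) s).
    apply Rabs_def2 in H1; apply Rabs_def2 in H2; lra.
- rewrite !approx_nonpos by lra; lra.
Qed.

Lemma approx_cauchy (T e : R) : 0 <= T -> 0 < e ->
  exists N, forall k m t, (N <= k)%nat -> (N <= m)%nat -> t <= T -> Rabs (U k t - U m t) <= e.
Proof using Hg HM HL Hos.
intros HT He.
assert (HP : 0 < 2 * T * exp (L * T) + 1).
{ assert (0 <= 2 * T * exp (L * T)); [|lra].
  apply Rmult_le_pos; [lra|apply Rlt_le, exp_pos]. }
(* The [+ 1] keeps the denominator positive when [T = 0]. *)
set (δ := e / (2 * T * exp (L * T) + 1)).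
assert (Hδ : 0 < δ) by (apply Rdiv_lt_0_compat; assumption).
assert (Hδe : δ * (2 * T * exp (L * T) + 1) = e) by (unfold δ; field; lra).
destruct (Hg δ Hδ) as [d [Hd0 Hd]].
destruct (step_small d Hd0) as [N1 HN1].
destruct (INR_unbounded T) as [N2 HN2].
assert (Hone : forall k m t, (N1 + N2 <= k)%nat -> (N1 + N2 <= m)%nat -> t <= T ->
  U k t - U m t <= e).
{ intros k m t Hk Hm Ht.
  destruct (Rle_lt_dec t 0) as [Ht0|Ht0].
  { rewrite !approx_nonpos by lra; lra. }
  assert (HNk : INR N2 <= INR k) by (apply le_INR; lia).
  assert (HNm : INR N2 <= INR m) by (apply le_INR; lia).
  apply Rle_trans with (2 * δ * t * exp (L * t)).
  - apply (approx_close k m δ d t); try assumption; try lra; apply HN1; lia.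
  - assert (Hexp : exp (L * t) <= exp (L * T)).
    { assert (HLt : L * t <= L * T) by (apply Rmult_le_compat_l; assumption).
      destruct HLt as [HLt|HLt]; [apply Rlt_le, exp_increasing, HLt|rewrite HLt; lra]. }
    assert (t * exp (L * t) <= T * exp (L * T)).
    { apply Rmult_le_compat; try lra; apply Rlt_le, exp_pos. }
    nra. }
exists (N1 + N2)%nat; intros k m t Hk Hm Ht.
apply Rabs_le; split; [|apply Hone; assumption].
assert (H := Hone m k t Hm Hk Ht); lra.
Qed.

Let u (t : R) : R := real (Lim_seq (fun k => U k t)).

Lemma approx_cvg (t : R) : is_lim_seq (fun k => U k t) (u t).
Proof using Hg HM HL Hos.
apply Lim_seq_correct', ex_lim_seq_cauchy_corr; intros e.
destruct (approx_cauchy (Rmax 0 t) (e / 2)) as [N HN]; [apply Rmax_l|apply is_pos_div_2|].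
exists N; intros n m Hn Hm.
apply Rle_lt_trans with (e / 2); [apply HN; try assumption; apply Rmax_r|].
assert (H := cond_pos e); lra.
Qed.

Lemma approx_cvg_unif (T e : R) : 0 <= T -> 0 < e ->
  exists N, forall k t, (N <= k)%nat -> t <= T -> Rabs (U k t - u t) <= e.
Proof using Hg HM HL Hos.
intros HT He; destruct (approx_cauchy T e HT He) as [N HN].
exists N; intros k t Hk Ht.
apply (is_lim_seq_le_loc (fun m => Rabs (U k t - U m t)) (fun _ => e)
  (Rabs (U k t - u t)) e); [|apply (is_lim_seq_abs _ (Finite (U k t - u t)))|apply is_lim_seq_const].
- exists N; intros m Hm; apply HN; assumption.
- apply is_lim_seq_minus'; [apply is_lim_seq_const|apply approx_cvg].
Qed.

Lemma limit_lip (x y : R) : Rabs (u x - u y) <= M * Rabs (x - y).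
Proof using Hg HM HL Hos.
apply (is_lim_seq_le (fun k => Rabs (U k x - U k y)) (fun _ => M * Rabs (x - y))
  (Rabs (u x - u y)) (M * Rabs (x - y))).
- intros k; apply tonelli_lip.
- apply (is_lim_seq_abs _ (Finite (u x - u y))).
  apply is_lim_seq_minus'; apply approx_cvg.
- apply is_lim_seq_const.
Qed.

(** Uniform convergence up to time [t] and uniform continuity of [g] allow passing to the limit
    under the integral. The form [s - 0] is the delayed integrand with [h = 0], so the lemmas on
    delays apply. *)
Lemma limit_integral (t : R) : 0 <= t -> u t = c + RInt (fun s => g (u (s - 0)) s) 0 t.
Proof using Hg HM HL Hos.
intros Ht.
assert (Huc : forall s, continuous u s) by exact (continuous_of_lip u M limit_lip).
apply Rminus_diag_uniq.
set (X := u t - (c + RInt (fun s => g (u (s - 0)) s) 0 t)).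
assert (HX : Rabs X <= 0); [|destruct (Req_dec X 0) as [|Hne]; [assumption|
  assert (H := Rabs_pos_lt X Hne); lra]].
apply le_epsilon; intros e He; rewrite Rplus_0_l.
set (δ := e / (2 * (t + 1))).
assert (Hδ : 0 < δ) by (apply Rdiv_lt_0_compat; lra).
assert (Hδe : δ * t <= e / 2).
{ assert (δ * (t + 1) = e / 2) by (unfold δ; field; lra); lra. }
destruct (Hg δ Hδ) as [d [Hd0 Hd]].
(* Delay and approximation error each move the argument of [g] by at most [d / 3], together less
   than [d]; the bound [e / 2] is for the value at [t] itself. *)
set (d' := Rmin (d / 3) (e / 2)).
assert (Hd'0 : 0 < d') by (apply Rmin_pos; lra).
assert (Hd'1 : d' <= d / 3) by apply Rmin_l.
assert (Hd'2 : d' <= e / 2) by apply Rmin_r.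
destruct (step_small (d / 3)) as [N1 HN1]; [lra|].
destruct (approx_cvg_unif t d' Ht Hd'0) as [N2 HN2].
destruct (INR_unbounded t) as [N3 HN3].
set (k := (N1 + N2 + N3)%nat).
assert (Hk3 : INR N3 <= INR k) by (apply le_INR; unfold k; lia).
assert (Hk1 : M * step k < d / 3) by (apply HN1; unfold k; lia).
assert (Hk2 : forall s, s <= t -> Rabs (U k s - u s) <= d') by (intros; apply HN2; [unfold k; lia|assumption]).
set (F := fun s => g (tonelli g c (step k) (iters k) (s - step k)) s).
assert (HF : ex_RInt F 0 t).
{ apply ex_RInt_along; [exact Hg|exact (continuous_of_lip _ M (tonelli_lip _ _))]. }
assert (HG : ex_RInt (fun s => g (u (s - 0)) s) 0 t) by (apply ex_RInt_along; assumption).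
assert (HU : U k t = c + RInt F 0 t).
{ unfold U; simpl; rewrite (Rmax_right 0 t) by assumption; reflexivity. }
assert (Hint : Rabs (RInt (fun s => F s - g (u (s - 0)) s) 0 t) <= δ * Rabs (t - 0)).
{ apply abs_RInt_le; [apply (ex_RInt_minus (V := R_NormedModule)); assumption|].
  rewrite Rmin_left, Rmax_right by assumption; intros s Hs.
  apply Rlt_le, Hd; [|rewrite Rminus_diag, Rabs_R0; assumption].
  rewrite <- approx_delay, Rminus_0_r by lra.
  assert (H1 := approx_delay_close k s _ Hk1).
  assert (H2 := Hk2 s (proj2 Hs)).
  replace (U k (s - step k) - u s) with ((U k (s - step k) - U k s) + (U k s - u s)) by ring.
  eapply Rle_lt_trans; [apply Rabs_triang|lra]. }
rewrite (RInt_minus (V := R_CompleteNormedModule) F (fun s => g (u (s - 0)) s)) in Hint by assumption.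
unfold minus, plus, opp in Hint; simpl in Hint.
rewrite Rminus_0_r, (Rabs_right t) in Hint by lra.
assert (H3 := Hk2 t (Rle_refl t)).
replace X with (- (U k t - u t) + (RInt F 0 t + - RInt (fun s => g (u (s - 0)) s) 0 t))
  by (unfold X; rewrite HU; ring).
eapply Rle_trans; [apply Rabs_triang|rewrite Rabs_Ropp; lra].
Qed.

Lemma global_sol_exists : exists u, global_sol g c u.
Proof using Hg HM HL Hos.
assert (Huc : forall s, continuous u s) by exact (continuous_of_lip u M limit_lip).
set (F := fun s => g (u (s - 0)) s).
assert (Hc : forall s, continuous F s) by (intros; apply continuous_along; assumption).
exists u; split; [|split; [assumption|]].
- rewrite limit_integral, RInt_point by lra; unfold zero; simpl; ring.
- intros t Ht.
  apply (is_derive_ext_loc (fun t => c + RInt F 0 t)).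
  + exists (mkposreal t Ht); intros s Hs.
    change (Rabs (s - t) < t) in Hs; apply Rabs_def2 in Hs.
    symmetry; apply limit_integral; lra.
  + replace (g (u t) t) with (0 + F t) by (unfold F; rewrite Rminus_0_r; ring).
    apply (is_derive_plus (fun _ => c) (fun t => RInt F 0 t)); [apply @is_derive_const|].
    apply (is_derive_RInt (V := R_CompleteNormedModule) F _ 0 t); [|apply Hc].
    apply filter_forall; intros x; apply (RInt_correct (V := R_CompleteNormedModule)).
    apply (ex_RInt_continuous (V := R_CompleteNormedModule)); intros; apply Hc.
Qed.

End Existence.

(** * Hypotheses on the drift, and solutions on the half-line *)

Lemma dist4_le (r τ u t r' τ' u' t' : R) :
  dist4 r τ u t r' τ' u' t' <= Rabs (r - r') + Rabs (τ - τ') + Rabs (u - u') + Rabs (t - t').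
Proof.
unfold dist4.
assert (H1 := Rabs_pos (r - r')); assert (H2 := Rabs_pos (τ - τ')).
assert (H3 := Rabs_pos (u - u')); assert (H4 := Rabs_pos (t - t')).
rewrite <- (sqrt_pow2 (Rabs (r - r') + Rabs (τ - τ') + Rabs (u - u') + Rabs (t - t'))) by lra.
apply sqrt_le_1_alt.
rewrite <- (pow2_abs (r - r')), <- (pow2_abs (τ - τ')), <- (pow2_abs (u - u')), <- (pow2_abs (t - t')).
set (a := Rabs (r - r')) in *; set (b := Rabs (τ - τ')) in *.
set (x := Rabs (u - u')) in *; set (y := Rabs (t - t')) in *.
assert (0 <= a * b) by (apply Rmult_le_pos; assumption).
assert (0 <= a * x) by (apply Rmult_le_pos; assumption).
assert (0 <= a * y) by (apply Rmult_le_pos; assumption).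
assert (0 <= b * x) by (apply Rmult_le_pos; assumption).
assert (0 <= b * y) by (apply Rmult_le_pos; assumption).
assert (0 <= x * y) by (apply Rmult_le_pos; assumption).
simpl; lra.
Qed.

(** The Lipschitz bound is taken in the sum distance, where equal arguments simply drop out;
    [dist4_le] derives it from the Euclidean one with the same constant. *)
Record periodic_drift (f : R -> R -> R -> R -> R) (κ M : R) : Prop := {
  drift_lip_pos : 0 < κ;
  drift_bound : forall r τ u t, Rabs (f r τ u t) <= M;
  drift_lip : forall r τ u t r' τ' u' t',
    Rabs (f r τ u t - f r' τ' u' t') <=
      κ * (Rabs (r - r') + Rabs (τ - τ') + Rabs (u - u') + Rabs (t - t'));
  drift_per_r : forall r τ u t, f (r + 1) τ u t = f r τ u t;
  drift_per_τ : forall r τ u t, f r (τ + 1) u t = f r τ u t;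
  drift_noninc : forall r τ u u' t, u <= u' -> f r τ u' t <= f r τ u t }.

(** This repeats the hypothesis on [fbar] in the theorem, so that it can be folded by conversion. *)
Definition effective_drift (f : R -> R -> R -> R -> R) (fbar : R -> R -> R) : Prop :=
  forall u0 t0 c t (ue : R -> R -> R),
    0 < t ->
    (forall eps, 0 < eps ->
       ode_sol (fun x s => f (x / eps) (s / eps) u0 t0) c (ue eps)) ->
    filterlim (fun eps => ue eps t) (at_right 0) (locally (c + fbar u0 t0 * t)).

Lemma global_sol_ode_sol (g : R -> R -> R) (c : R) (u : R -> R) :
  global_sol g c u -> ode_sol g c u.
Proof.
intros [H0 [Hc Hd]]; split; [exact H0|split; [|exact Hd]].
rewrite <- H0; apply filterlim_filter_le_1 with (2 := Hc 0).
intros P [d H]; exists d; intros y Hy _; exact (H y Hy).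
Qed.

(** Stopping time at 0, as in [u (Rmax 0 t)], turns the one-sided limit at 0 into continuity on the
    whole line. *)
Lemma ode_sol_global_sol (g : R -> R -> R) (c : R) (u : R -> R) :
  ode_sol g c u -> exists v, global_sol g c v /\ forall t, 0 <= t -> u t = v t.
Proof.
intros [H0 [Hc Hd]].
exists (fun t => u (Rmax 0 t)).
assert (Hpos : forall t, 0 < t -> is_derive (fun t => u (Rmax 0 t)) t (g (u (Rmax 0 t)) t)).
{ intros t Ht; apply (is_derive_ext_loc u).
  - exists (mkposreal t Ht); intros s Hs.
    change (Rabs (s - t) < t) in Hs; apply Rabs_def2 in Hs.
    rewrite Rmax_right by lra; reflexivity.
  - rewrite Rmax_right by lra; apply Hd, Ht. }
split; [split; [|split; [|exact Hpos]]|].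
- rewrite Rmax_left by lra; exact H0.
- intros t; destruct (Rlt_le_dec 0 t) as [Ht|Ht].
  + apply (ex_derive_continuous (fun t => u (Rmax 0 t))).
    eexists; exact (Hpos t Ht).
  + apply continuous_of_ball; intros e He.
    rewrite (Rmax_left 0 t) by assumption; rewrite H0.
    destruct (proj1 (filterlim_locally u c) Hc (mkposreal e He)) as [d Hball].
    exists d; split; [apply cond_pos|]; intros s Hs.
    destruct (Rlt_le_dec 0 s) as [Hs0|Hs0].
    * rewrite Rmax_right by lra; apply Hball; [|exact Hs0].
      change (Rabs (s - 0) < d); apply Rabs_def2 in Hs; apply Rabs_def1; lra.
    * rewrite Rmax_left, H0, Rminus_diag, Rabs_R0 by assumption; exact He.
- intros t Ht; rewrite Rmax_right by assumption; reflexivity.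
Qed.

(** A mean value inequality without derivative at [a]: Gronwall with [L = 0], applied to [u] and to
    [- u]. *)
Lemma increment_bound (u du : R -> R) (a b M : R) :
  a <= b -> (forall t, continuous u t) ->
  (forall t, a < t <= b -> is_derive u t (du t) /\ Rabs (du t) <= M) ->
  Rabs (u b - u a) <= M * (b - a).
Proof.
intros Hab Hc Hd.
destruct Hab as [Hab|Hab]; [|rewrite Hab, !Rminus_diag, Rabs_R0, Rmult_0_r; lra].
assert (HM : 0 <= M).
{ destruct (Hd b) as [_ H]; [lra|]; eapply Rle_trans; [apply Rabs_pos|exact H]. }
assert (Hup : forall v dv, (forall t, continuous v t) ->
  (forall t, a < t <= b -> is_derive v t (dv t) /\ dv t <= M) -> v b - v a <= M * (b - a)).
{ intros v dv Hvc Hv.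
  assert (H : v b - v a <= (0 + M * (b - a)) * exp (0 * (b - a)));
    [|rewrite Rmult_0_l, exp_0 in H; lra].
  apply (one_sided_gronwall (fun t => v t - v a)); try lra.
  - intros t _; apply (continuous_minus v (fun _ => v a)); [apply Hvc|apply continuous_const].
  - intros t Ht _; destruct (Hv t Ht) as [H1 H2].
    exists (dv t - 0); split; [|lra].
    apply (is_derive_minus v (fun _ => v a)); [exact H1|apply @is_derive_const]. }
apply Rabs_le; split.
- assert (H := Hup (fun t => - u t) (fun t => - du t)).
  assert (- u b - - u a <= M * (b - a)); [|lra].
  apply H.
  + intros t; apply (continuous_opp u), Hc.
  + intros t Ht; destruct (Hd t Ht) as [H1 H2]; split.
    * apply (is_derive_opp u), H1.
    * apply Rabs_le_between in H2; lra.
- apply (Hup u du Hc); intros t Ht; destruct (Hd t Ht) as [H1 H2]; split; [exact H1|].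
  apply Rabs_le_between in H2; lra.
Qed.

(** * Comparison modulo integer translates *)

Lemma periodic_IZR (h : R -> R) :
  (forall x, h (x + 1) = h x) -> forall (m : Z) x, h (x + IZR m) = h x.
Proof.
intros Hh.
assert (Hn : forall (n : nat) x, h (x + INR n) = h x).
{ induction n as [|n IH]; intros x; [rewrite Rplus_0_r; reflexivity|].
  rewrite S_INR, <- Rplus_assoc, Hh; apply IH. }
intros m x; destruct (Z.le_gt_cases 0 m) as [Hm|Hm].
- rewrite <- (Z2Nat.id m Hm), <- INR_IZR_INZ; apply Hn.
- rewrite <- (Hn (Z.to_nat (- m)) (x + IZR m)), INR_IZR_INZ, Z2Nat.id by lia.
  f_equal; rewrite opp_IZR; ring.
Qed.

(** By periodicity in the first argument [Y + m] satisfies the same equation as [Y]. While [X] lies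
    above it, the gap grows at rate at most [κ] times itself plus [κ * d]. The slow arguments are
    functions of time, to cover both frozen and moving parameters. *)
Lemma drift_comparison f κ M (X Y pX qX pY qY : R -> R) (a b d : R) (m : Z) :
  periodic_drift f κ M -> a <= b -> 0 <= d ->
  (forall t, continuous X t) -> (forall t, continuous Y t) ->
  (forall t, a < t <= b -> is_derive X t (f (X t) t (pX t) (qX t))) ->
  (forall t, a < t <= b -> is_derive Y t (f (Y t) t (pY t) (qY t))) ->
  (forall t, a < t <= b -> Rabs (pX t - pY t) + Rabs (qX t - qY t) <= d) ->
  X a <= Y a + IZR m ->
  X b <= Y b + IZR m + κ * d * (b - a) * exp (κ * (b - a)).
Proof.
intros Hf Hab Hd HXc HYc HX HY Hpq Ha.
assert (Hκ := drift_lip_pos _ _ _ Hf).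
assert (H : X b - (Y b + IZR m) <= (0 + κ * d * (b - a)) * exp (κ * (b - a)));
  [|rewrite Rplus_0_l in H; lra].
apply (one_sided_gronwall (fun t => X t - (Y t + IZR m))); try lra.
- apply Rmult_le_pos; lra.
- intros t _; apply (continuous_minus X (fun t => Y t + IZR m)); [apply HXc|].
  apply (continuous_plus Y (fun _ => IZR m)); [apply HYc|apply continuous_const].
- intros t Ht Hpos.
  exists (f (X t) t (pX t) (qX t) - (f (Y t) t (pY t) (qY t) + 0)); split.
  + apply (is_derive_minus X (fun t => Y t + IZR m)); [apply HX, Ht|].
    apply (is_derive_plus Y (fun _ => IZR m)); [apply HY, Ht|apply @is_derive_const].
  + rewrite Rplus_0_r.
    assert (Hper := periodic_IZR (fun r => f r t (pY t) (qY t))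
      (fun r => drift_per_r _ _ _ Hf r _ _ _) m (Y t)).
    simpl in Hper; rewrite <- Hper.
    assert (Hl := drift_lip _ _ _ Hf (X t) t (pX t) (qX t) (Y t + IZR m) t (pY t) (qY t)).
    rewrite Rminus_diag, Rabs_R0, (Rabs_right (X t - (Y t + IZR m))) in Hl by lra.
    apply Rabs_le_between in Hl; specialize (Hpq t Ht).
    assert (κ * (Rabs (pX t - pY t) + Rabs (qX t - qY t)) <= κ * d)
      by (apply Rmult_le_compat_l; lra).
    lra.
Qed.

Lemma drift_joint_ucont f κ M u0 t0 :
  periodic_drift f κ M -> joint_ucont (fun x s => f x s u0 t0).
Proof.
intros Hf e He; assert (Hκ := drift_lip_pos _ _ _ Hf).
exists (e / (2 * κ)); split; [apply Rdiv_lt_0_compat; lra|].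
intros x y t s Hx Ht.
eapply Rle_lt_trans; [apply (drift_lip _ _ _ Hf)|].
rewrite !Rminus_diag, Rabs_R0, !Rplus_0_r.
apply Rlt_le_trans with (κ * (e / (2 * κ) + e / (2 * κ))).
- apply Rmult_lt_compat_l; lra.
- right; field; lra.
Qed.

Lemma frozen_sol_exists f κ M u0 t0 :
  periodic_drift f κ M -> exists W, global_sol (fun x s => f x s u0 t0) 0 W.
Proof.
intros Hf; assert (Hκ := drift_lip_pos _ _ _ Hf).
apply (global_sol_exists _ 0 M κ (drift_joint_ucont _ _ _ u0 t0 Hf)
  (fun x t => drift_bound _ _ _ Hf x t u0 t0)); [lra|].
intros x y t Hxy; assert (H := drift_lip _ _ _ Hf x t u0 t0 y t u0 t0).
rewrite !Rminus_diag, Rabs_R0, !Rplus_0_r, (Rabs_right (x - y)) in H by lra.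
apply Rabs_le_between in H; lra.
Qed.

(* [u^eps(s) = eps W(s / eps)] solves the [eps]-problem with datum 0, so that at
   [s = 1] the definition of [fbar] becomes the rotation number of [W]. *)
Lemma rotation_number f fbar u0 t0 W e :
  effective_drift f fbar -> global_sol (fun x s => f x s u0 t0) 0 W -> 0 < e ->
  exists S, 0 < S /\ forall s, S < s -> Rabs (W s - fbar u0 t0 * s) <= e * s.
Proof.
intros Hbar [HW0 [HWc HWd]] He.
assert (Hlim := Hbar u0 t0 0 1 (fun eps s => eps * W (s / eps)) Rlt_0_1).
assert (Hsol : forall eps, 0 < eps ->
  ode_sol (fun x s => f (x / eps) (s / eps) u0 t0) 0 (fun s => eps * W (s / eps))).
{ intros eps Heps; apply global_sol_ode_sol; split; [|split].
  - unfold Rdiv; rewrite Rmult_0_l, HW0; ring.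
  - intros t; apply (continuous_mult (fun _ => eps) (fun s => W (s / eps)));
      [apply continuous_const|].
    apply (continuous_comp (fun s => s / eps) W); [|apply HWc].
    apply (ex_derive_continuous (fun s => s / eps)); auto_derive; lra.
  - intros t Ht.
    assert (Hte : 0 < t / eps) by (apply Rdiv_lt_0_compat; assumption).
    replace (eps * W (t / eps) / eps) with (W (t / eps)) by (field; lra).
    replace (f (W (t / eps)) (t / eps) u0 t0)
      with (eps * (/ eps * f (W (t / eps)) (t / eps) u0 t0)) by (field; lra).
    apply (is_derive_scal (fun s => W (s / eps))).
    apply (is_derive_comp W (fun s => s / eps)); [apply HWd, Hte|].
    auto_derive; [lra|]; field; lra. }
specialize (Hlim Hsol).
destruct (proj1 (filterlim_locally _ _) Hlim (mkposreal e He)) as [d Hd].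
exists (/ d); split; [apply Rinv_0_lt_compat, cond_pos|].
intros s Hs.
assert (Hd0 := cond_pos d).
assert (Hs0 : 0 < s) by (eapply Rlt_trans; [apply Rinv_0_lt_compat, Hd0|exact Hs]).
assert (Hsd : / s < d).
{ rewrite <- (Rinv_inv d); apply Rinv_lt_contravar; [|exact Hs].
  apply Rmult_lt_0_compat; [apply Rinv_0_lt_compat, Hd0|exact Hs0]. }
assert (Hinv : 0 < / s) by (apply Rinv_0_lt_compat, Hs0).
assert (Hball : Rabs (/ s * W (1 / / s) - (0 + fbar u0 t0 * 1)) < e).
{ apply (Hd (/ s)); [|exact Hinv].
  change (Rabs (/ s - 0) < d); rewrite Rminus_0_r, Rabs_right; lra. }
replace (1 / / s) with s in Hball by (field; lra).
replace (W s - fbar u0 t0 * s) with (s * (/ s * W s - (0 + fbar u0 t0 * 1))) by (field; lra).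
rewrite Rabs_mult, (Rabs_right s), Rmult_comm by lra.
apply Rmult_le_compat_r; lra.
Qed.

(** Dividing by [k * s0] and letting [k] grow compares the asymptotic slopes, so it suffices to
    compare at multiples of [s0], with a gain [K] per step. *)
Lemma rate_le (r1 r2 s0 K : R) (W1 W2 : R -> R) :
  0 < s0 ->
  (forall e, 0 < e -> exists S, 0 < S /\ forall s, S < s -> Rabs (W1 s - r1 * s) <= e * s) ->
  (forall e, 0 < e -> exists S, 0 < S /\ forall s, S < s -> Rabs (W2 s - r2 * s) <= e * s) ->
  (forall k : nat, W2 (INR k * s0) <= W1 (INR k * s0) + INR k * K) ->
  r2 <= r1 + K / s0.
Proof.
intros Hs0 H1 H2 Hk.
apply le_epsilon; intros e He.
destruct (H1 (e / 2)) as [S1 [HS1 H1']]; [lra|].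
destruct (H2 (e / 2)) as [S2 [HS2 H2']]; [lra|].
destruct (INR_unbounded ((S1 + S2) / s0)) as [k Hk0].
apply Rmult_lt_compat_r with (r := s0) in Hk0; [|exact Hs0].
unfold Rdiv in Hk0; rewrite Rmult_assoc, Rinv_l, Rmult_1_r in Hk0 by lra.
specialize (Hk k); specialize (H1' (INR k * s0)); specialize (H2' (INR k * s0)).
set (s := INR k * s0) in *.
assert (Hks : INR k * K = K / s0 * s) by (unfold s; field; lra).
rewrite Hks in Hk.
assert (A1 : Rabs (W1 s - r1 * s) <= e / 2 * s) by (apply H1'; lra).
assert (A2 : Rabs (W2 s - r2 * s) <= e / 2 * s) by (apply H2'; lra).
apply Rabs_le_between in A1; apply Rabs_le_between in A2.
apply Rmult_le_reg_r with s; [lra|]; lra.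
Qed.

(** * Modulus of continuity, bound and monotonicity of the effective drift *)

Lemma integer_part (x : R) : exists m : Z, IZR m <= x < IZR m + 1.
Proof.
exists (Int_part x); assert (H := base_Int_part x); lra.
Qed.

(** After [k] steps [W2] is compared with the translate [W1 + k], again a solution, so Gronwall
    restarts with zero initial gap. The factor [exp (κ * s0)] thus never compounds, and each step
    adds at most 1. *)
Lemma drift_modulus_le f κ M fbar u1 t1 u2 t2 s0 :
  periodic_drift f κ M -> effective_drift f fbar -> 0 < s0 ->
  (Rabs (u1 - u2) + Rabs (t1 - t2)) * (κ * s0 * exp (κ * s0)) <= 1 ->
  fbar u2 t2 <= fbar u1 t1 + 1 / s0.
Proof.
intros Hf Hbar Hs0 Hd.
destruct (frozen_sol_exists f κ M u1 t1 Hf) as [W1 HW1].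
destruct (frozen_sol_exists f κ M u2 t2 Hf) as [W2 HW2].
apply (rate_le _ _ s0 1 W1 W2 Hs0).
- intros e He; exact (rotation_number f fbar u1 t1 W1 e Hbar HW1 He).
- intros e He; exact (rotation_number f fbar u2 t2 W2 e Hbar HW2 He).
- destruct HW1 as [HW10 [HW1c HW1d]]; destruct HW2 as [HW20 [HW2c HW2d]].
  induction k as [|k IH]; [simpl; rewrite !Rmult_0_l, HW10, HW20; lra|].
  assert (Hk := pos_INR k).
  assert (0 <= INR k * s0) by (apply Rmult_le_pos; lra).
  assert (H0 : W2 (INR (S k) * s0) <= W1 (INR (S k) * s0) + IZR (Z.of_nat k) +
    κ * (Rabs (u1 - u2) + Rabs (t1 - t2)) * (INR (S k) * s0 - INR k * s0) *
    exp (κ * (INR (S k) * s0 - INR k * s0))).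
  { apply (drift_comparison f κ M W2 W1 (fun _ => u2) (fun _ => t2) (fun _ => u1) (fun _ => t1));
      try assumption.
    - rewrite S_INR; lra.
    - apply Rplus_le_le_0_compat; apply Rabs_pos.
    - intros t Ht; apply HW2d; lra.
    - intros t Ht; apply HW1d; lra.
    - intros t _; rewrite (Rabs_minus_sym u2), (Rabs_minus_sym t2); lra.
    - rewrite <- INR_IZR_INZ; lra. }
  rewrite <- INR_IZR_INZ in H0.
  replace (INR (S k) * s0 - INR k * s0) with s0 in H0 by (rewrite S_INR; ring).
  rewrite S_INR in *; lra.
Qed.

Lemma drift_modulus f κ M fbar u1 t1 u2 t2 s0 :
  periodic_drift f κ M -> effective_drift f fbar -> 0 < s0 ->
  (Rabs (u1 - u2) + Rabs (t1 - t2)) * (κ * s0 * exp (κ * s0)) <= 1 ->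
  Rabs (fbar u1 t1 - fbar u2 t2) <= 1 / s0.
Proof.
intros Hf Hbar Hs0 Hd.
assert (H1 := drift_modulus_le f κ M fbar u1 t1 u2 t2 s0 Hf Hbar Hs0 Hd).
rewrite Rabs_minus_sym, (Rabs_minus_sym t1) in Hd.
assert (H2 := drift_modulus_le f κ M fbar u2 t2 u1 t1 s0 Hf Hbar Hs0 Hd).
apply Rabs_le; lra.
Qed.

Lemma frozen_sol_lip f κ M u0 t0 W a b :
  periodic_drift f κ M -> global_sol (fun x s => f x s u0 t0) 0 W ->
  0 <= a <= b -> Rabs (W b - W a) <= M * (b - a).
Proof.
intros Hf [_ [HWc HWd]] Hab.
apply (increment_bound W (fun t => f (W t) t u0 t0)); [lra|exact HWc|].
intros t Ht; split; [apply HWd; lra|apply (drift_bound _ _ _ Hf)].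
Qed.

Lemma effective_drift_bound f κ M fbar u0 t0 :
  periodic_drift f κ M -> effective_drift f fbar -> Rabs (fbar u0 t0) <= M.
Proof.
intros Hf Hbar.
destruct (frozen_sol_exists f κ M u0 t0 Hf) as [W HW].
apply le_epsilon; intros e He.
destruct (rotation_number f fbar u0 t0 W e Hbar HW He) as [S [HS H]].
specialize (H (S + 1)).
assert (Hl : Rabs (W (S + 1) - W 0) <= M * (S + 1 - 0))
  by (apply (frozen_sol_lip f κ M u0 t0); [assumption|assumption|lra]).
rewrite (proj1 HW), !Rminus_0_r in Hl.
assert (H' : Rabs (W (S + 1) - fbar u0 t0 * (S + 1)) <= e * (S + 1)) by (apply H; lra).
apply Rmult_le_reg_r with (S + 1); [lra|].
rewrite <- (Rabs_right (S + 1)) at 1 by lra; rewrite <- Rabs_mult.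
replace (fbar u0 t0 * (S + 1)) with (W (S + 1) - (W (S + 1) - fbar u0 t0 * (S + 1))) by ring.
eapply Rle_trans; [apply Rabs_triang|rewrite Rabs_Ropp; lra].
Qed.

(** Where [W2 > W1], monotonicity of [f] in [u] leaves only the Lipschitz term in the first
    variable; Gronwall without forcing gives [W2 <= W1], and [rate_le] applies with [K = 0]. *)
Lemma effective_drift_noninc f κ M fbar u1 u2 t0 :
  periodic_drift f κ M -> effective_drift f fbar -> u1 <= u2 -> fbar u2 t0 <= fbar u1 t0.
Proof.
intros Hf Hbar Hu.
destruct (frozen_sol_exists f κ M u1 t0 Hf) as [W1 HW1].
destruct (frozen_sol_exists f κ M u2 t0 Hf) as [W2 HW2].
assert (H : fbar u2 t0 <= fbar u1 t0 + 0 / 1); [|lra].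
apply (rate_le _ _ 1 0 W1 W2 Rlt_0_1).
- intros e He; exact (rotation_number f fbar u1 t0 W1 e Hbar HW1 He).
- intros e He; exact (rotation_number f fbar u2 t0 W2 e Hbar HW2 He).
- destruct HW1 as [HW10 [HW1c HW1d]]; destruct HW2 as [HW20 [HW2c HW2d]].
  intros k; rewrite Rmult_1_r; assert (Hk := pos_INR k).
  assert (Hκ := drift_lip_pos _ _ _ Hf).
  assert (H : W2 (INR k) - W1 (INR k) <= (0 + 0 * (INR k - 0)) * exp (κ * (INR k - 0)));
    [|lra].
  apply (one_sided_gronwall (fun t => W2 t - W1 t)); try lra.
  + intros t _; apply (continuous_minus W2 W1); [apply HW2c|apply HW1c].
  + intros t Ht Hpos.
    exists (f (W2 t) t u2 t0 - f (W1 t) t u1 t0); split.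
    * apply (is_derive_minus W2 W1); [apply HW2d|apply HW1d]; lra.
    * assert (H1 := drift_noninc _ _ _ Hf (W2 t) t u1 u2 t0 Hu).
      assert (H2 := drift_lip _ _ _ Hf (W2 t) t u1 t0 (W1 t) t u1 t0).
      rewrite !Rminus_diag, Rabs_R0, !Rplus_0_r, (Rabs_right (W2 t - W1 t)) in H2 by lra.
      apply Rabs_le_between in H2; lra.
Qed.

Lemma effective_drift_joint_ucont f κ M fbar :
  periodic_drift f κ M -> effective_drift f fbar -> joint_ucont fbar.
Proof.
intros Hf Hbar e He; assert (Hκ := drift_lip_pos _ _ _ Hf).
(* With step [2 / e] the modulus [1 / s0] equals [e / 2]. *)
assert (Hs0 : 0 < 2 / e) by (apply Rdiv_lt_0_compat; lra).
set (Q := κ * (2 / e) * exp (κ * (2 / e))).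
assert (HQ : 0 < Q).
{ apply Rmult_lt_0_compat; [apply Rmult_lt_0_compat; assumption|apply exp_pos]. }
exists (1 / (2 * Q)); split; [apply Rdiv_lt_0_compat; lra|].
intros x y t s Hx Ht.
apply Rle_lt_trans with (1 / (2 / e)).
- apply (drift_modulus f κ M); try assumption; fold Q.
  apply Rle_trans with ((1 / (2 * Q) + 1 / (2 * Q)) * Q).
  + apply Rmult_le_compat_r; lra.
  + right; field; lra.
- replace (1 / (2 / e)) with (e / 2) by (field; lra); lra.
Qed.

(** * Bounded distance of a frozen solution from its linear growth *)

(** By periodicity in time, [W (n + s)] solves the same frozen equation as [W s]. If [m] is the
    integer part of [W n], it stays between [W s + m] and [W s + m + 1]. *)
Lemma frozen_sol_quasi_additive f κ M u0 t0 W (n : nat) s :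
  periodic_drift f κ M -> global_sol (fun x s => f x s u0 t0) 0 W -> 0 <= s ->
  Rabs (W (INR n + s) - W (INR n) - W s) <= 1.
Proof.
intros Hf [HW0 [HWc HWd]] Hs.
assert (Hn := pos_INR n).
destruct (integer_part (W (INR n))) as [m Hm].
assert (HSc : forall t, continuous (fun s => W (INR n + s)) t).
{ intros t; apply (continuous_comp (fun s => INR n + s) W); [|apply HWc].
  apply (ex_derive_continuous (fun s => INR n + s)); auto_derive; trivial. }
assert (HSd : forall t, 0 < t <= s ->
  is_derive (fun s => W (INR n + s)) t (f (W (INR n + t)) t u0 t0)).
{ intros t Ht.
  assert (Hper := periodic_IZR (fun τ => f (W (INR n + t)) τ u0 t0)
    (fun τ => drift_per_τ _ _ _ Hf _ τ _ _) (Z.of_nat n) t).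
  rewrite <- INR_IZR_INZ, (Rplus_comm t) in Hper; simpl in Hper.
  replace (f (W (INR n + t)) t u0 t0) with (1 * f (W (INR n + t)) (INR n + t) u0 t0)
    by (rewrite Hper; ring).
  apply (is_derive_comp W (fun s => INR n + s)); [apply HWd; lra|].
  auto_derive; trivial; ring. }
assert (Hconst : forall t, 0 < t <= s -> Rabs (u0 - u0) + Rabs (t0 - t0) <= 0)
  by (intros; rewrite !Rminus_diag, Rabs_R0; lra).
assert (H1 := drift_comparison f κ M (fun s => W (INR n + s)) W
  (fun _ => u0) (fun _ => t0) (fun _ => u0) (fun _ => t0) 0 s 0 (m + 1) Hf Hs (Rle_refl 0)
  HSc HWc HSd (fun t Ht => HWd t (proj1 Ht)) Hconst).
assert (H2 := drift_comparison f κ M W (fun s => W (INR n + s))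
  (fun _ => u0) (fun _ => t0) (fun _ => u0) (fun _ => t0) 0 s 0 (- m) Hf Hs (Rle_refl 0)
  HWc HSc (fun t Ht => HWd t (proj1 Ht)) HSd Hconst).
rewrite plus_IZR, Rplus_0_r, HW0, Rmult_0_r, !Rmult_0_l in H1.
rewrite opp_IZR, Rplus_0_r, HW0, Rmult_0_r, !Rmult_0_l in H2.
apply Rabs_le; lra.
Qed.

(** Quasi-additivity iterates to an error of at most [k] between [W (k n)] and [k * W n]. Hence
    [rate_le], used in both directions against the line of slope [W n / n], puts [fbar] within
    [1 / n] of that slope. *)
Lemma rotation_error_nat f κ M fbar u0 t0 W (n : nat) :
  periodic_drift f κ M -> effective_drift f fbar ->
  global_sol (fun x s => f x s u0 t0) 0 W ->
  Rabs (W (INR n) - fbar u0 t0 * INR n) <= 1.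
Proof.
intros Hf Hbar HW.
destruct (Nat.eq_dec n 0) as [->|Hn0].
{ simpl; rewrite (proj1 HW), Rmult_0_r, Rminus_0_r, Rabs_R0; lra. }
assert (Hn : 0 < INR n) by (apply lt_0_INR; lia).
assert (Hk : forall k : nat, Rabs (W (INR k * INR n) - INR k * W (INR n)) <= INR k).
{ induction k as [|k IH]; [simpl; rewrite !Rmult_0_l, (proj1 HW), Rminus_0_r, Rabs_R0; lra|].
  assert (Hk := pos_INR k).
  assert (H := frozen_sol_quasi_additive f κ M u0 t0 W n (INR k * INR n) Hf HW
    (Rmult_le_pos _ _ Hk (Rlt_le _ _ Hn))).
  rewrite S_INR.
  replace ((INR k + 1) * INR n) with (INR n + INR k * INR n) by ring.
  apply Rabs_le_between in H; apply Rabs_le_between in IH; apply Rabs_le; lra. }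
assert (Hrate : forall e, 0 < e ->
  exists S, 0 < S /\ forall s, S < s -> Rabs (W s - fbar u0 t0 * s) <= e * s).
{ intros e He; exact (rotation_number f fbar u0 t0 W e Hbar HW He). }
assert (Hlin : forall r e, 0 < e ->
  exists S, 0 < S /\ forall s, S < s -> Rabs (r * s - r * s) <= e * s).
{ intros r e He; exists 1; split; [lra|]; intros s Hs.
  rewrite Rminus_diag, Rabs_R0; apply Rmult_le_pos; lra. }
assert (H1 : fbar u0 t0 <= W (INR n) / INR n + 1 / INR n).
{ apply (rate_le _ _ (INR n) 1 (fun s => W (INR n) / INR n * s) W Hn (Hlin _) Hrate).
  intros k; specialize (Hk k); apply Rabs_le_between in Hk.
  replace (W (INR n) / INR n * (INR k * INR n)) with (INR k * W (INR n)) by (field; lra); lra. }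
assert (H2 : W (INR n) / INR n <= fbar u0 t0 + 1 / INR n).
{ apply (rate_le _ _ (INR n) 1 W (fun s => W (INR n) / INR n * s) Hn Hrate (Hlin _)).
  intros k; specialize (Hk k); apply Rabs_le_between in Hk.
  replace (W (INR n) / INR n * (INR k * INR n)) with (INR k * W (INR n)) by (field; lra); lra. }
apply Rmult_le_compat_r with (r := INR n) in H1; [|lra].
apply Rmult_le_compat_r with (r := INR n) in H2; [|lra].
replace ((W (INR n) / INR n + 1 / INR n) * INR n) with (W (INR n) + 1) in H1 by (field; lra).
replace (W (INR n) / INR n * INR n) with (W (INR n)) in H2 by (field; lra).
replace ((fbar u0 t0 + 1 / INR n) * INR n) with (fbar u0 t0 * INR n + 1) in H2 by (field; lra).
apply Rabs_le; lra.
Qed.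

Lemma nat_part (x : R) : 0 <= x -> exists n : nat, INR n <= x < INR n + 1.
Proof.
intros Hx; destruct (integer_part x) as [m Hm].
assert (0 <= m)%Z.
{ assert (-1 < m)%Z; [|lia]; apply lt_IZR; lra. }
exists (Z.to_nat m); rewrite INR_IZR_INZ, Z2Nat.id by assumption; exact Hm.
Qed.

(** Rounding [s] down to an integer costs at most [M] for [W] and [M] for the linear term. *)
Lemma rotation_error f κ M fbar u0 t0 W s :
  periodic_drift f κ M -> effective_drift f fbar ->
  global_sol (fun x s => f x s u0 t0) 0 W -> 0 <= s ->
  Rabs (W s - fbar u0 t0 * s) <= 1 + 2 * M.
Proof.
intros Hf Hbar HW Hs.
destruct (nat_part s Hs) as [n Hn].
assert (Hn0 := pos_INR n).
assert (H1 := rotation_error_nat f κ M fbar u0 t0 W n Hf Hbar HW).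
assert (H2 : Rabs (W s - W (INR n)) <= M * (s - INR n))
  by (apply (frozen_sol_lip f κ M u0 t0); [assumption|assumption|lra]).
assert (H3 := effective_drift_bound f κ M fbar u0 t0 Hf Hbar).
assert (HM : 0 <= M) by (eapply Rle_trans; [apply Rabs_pos|exact H3]).
assert (H4 : M * (s - INR n) <= M) by nra.
assert (H5 : Rabs (fbar u0 t0 * (s - INR n)) <= M).
{ rewrite Rabs_mult, (Rabs_right (s - INR n)) by lra; nra. }
apply Rabs_le_between in H1; apply Rabs_le_between in H2; apply Rabs_le_between in H5.
apply Rabs_le; lra.
Qed.

(** * Existence and uniqueness for the effective equation *)

Lemma effective_sol_exists f κ M fbar c :
  periodic_drift f κ M -> effective_drift f fbar -> exists u, global_sol fbar c u.
Proof.
intros Hf Hbar.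
(* Monotonicity of [fbar] in [u] is a one-sided Lipschitz condition with constant 0. *)
apply (global_sol_exists fbar c M 0); [eapply effective_drift_joint_ucont; eassumption
  |intros; eapply effective_drift_bound; eassumption|lra|].
intros x y t Hxy; rewrite Rmult_0_l.
assert (H := effective_drift_noninc f κ M fbar y x t Hf Hbar); lra.
Qed.

(** Where [u > v] the difference has nonpositive derivative, so it never becomes positive. *)
Lemma noninc_sol_le (g : R -> R -> R) c u v t :
  (forall x y t, x <= y -> g y t <= g x t) ->
  global_sol g c u -> global_sol g c v -> 0 <= t -> u t <= v t.
Proof.
intros Hg [Hu0 [Huc Hud]] [Hv0 [Hvc Hvd]] Ht.
assert (H : u t - v t <= (0 + 0 * (t - 0)) * exp (0 * (t - 0)));
  [|rewrite Rmult_0_l, Rplus_0_r, Rmult_0_l in H; lra].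
apply (one_sided_gronwall (fun t => u t - v t)); try lra.
- intros s _; apply (continuous_minus u v); [apply Huc|apply Hvc].
- intros s Hs Hpos; exists (g (u s) s - g (v s) s); split.
  + apply (is_derive_minus u v); [apply Hud|apply Hvd]; lra.
  + assert (H := Hg (v s) (u s) s); lra.
Qed.

(** * Suprema and the Lambert W function *)

Lemma exp_le (x y : R) : x <= y -> exp x <= exp y.
Proof. intros [H|H]; [apply Rlt_le, exp_increasing, H|rewrite H; lra]. Qed.

(** [real] sends infinite values to 0; a bound and an element of [E] make the supremum finite. *)
Lemma real_Lub_ub (E : R -> Prop) (B x : R) :
  (forall y, E y -> y <= B) -> E x -> x <= real (Lub_Rbar E).
Proof.
intros HB Hx; destruct (Lub_Rbar_correct E) as [Hub Hlub].
specialize (Hub x Hx); specialize (Hlub (Finite B) HB).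
destruct (Lub_Rbar E); simpl in *; [assumption|contradiction|contradiction].
Qed.

Lemma real_Lub_le (E : R -> Prop) (B x : R) :
  (forall y, E y -> y <= B) -> E x -> real (Lub_Rbar E) <= B.
Proof.
intros HB Hx; destruct (Lub_Rbar_correct E) as [Hub Hlub].
specialize (Hub x Hx); specialize (Hlub (Finite B) HB).
destruct (Lub_Rbar E); simpl in *; [assumption|contradiction|contradiction].
Qed.

(** If [x * exp x > y], then the inequality fails at every [z >= x] by monotonicity and just below
    [x] by continuity, so the supremum defining [LambertW y] lies strictly below [x]. *)
Lemma LambertW_spec (x y : R) : 0 < y -> 0 <= x <= LambertW y -> x * exp x <= y.
Proof.
intros Hy [Hx HxW].
destruct (Rle_lt_dec (x * exp x) y) as [|Hlt]; [assumption|exfalso].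
destruct (continuous_lt_ball (fun z => z * exp z) x (x * exp x - y)) as [d [Hd Hball]];
  [apply (ex_derive_continuous (fun z => z * exp z)); auto_derive; trivial|lra|].
assert (LambertW y <= x - d); [|lra].
apply (real_Lub_le _ _ 0); [|split; [lra|rewrite Rmult_0_l; lra]].
intros z [Hz Hzy].
destruct (Rle_lt_dec z (x - d)) as [|Hzx]; [assumption|exfalso].
destruct (Rle_lt_dec x z) as [Hxz|Hxz].
- assert (x * exp x <= z * exp z); [|lra].
  apply Rmult_le_compat; [assumption|apply Rlt_le, exp_pos|assumption|apply exp_le, Hxz].
- assert (H : Rabs (z * exp z - x * exp x) < x * exp x - y)
    by (apply Hball, Rabs_def1; lra).
  apply Rabs_def2 in H; lra.
Qed.

(** * Averaging error in fast time *)

Section FastScale.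
Context (f : R -> R -> R -> R -> R) (κ M eps s0 : R) (fbar : R -> R -> R) (V Vb : R -> R).
Context (Hf : periodic_drift f κ M) (Hbar : effective_drift f fbar).
Context (Heps : 0 < eps) (Hs0 : 0 < s0).
Context (Hsmall : eps * ((M + 1) * s0) * (κ * s0 * exp (κ * s0)) <= 1).
Context (HVc : forall t, continuous V t) (HVbc : forall t, continuous Vb t).
Context (HVd : forall t, 0 < t -> is_derive V t (f (V t) t (eps * V t) (eps * t))).
Context (HVbd : forall t, 0 < t -> is_derive Vb t (fbar (eps * Vb t) (eps * t))).
Context (HV0 : V 0 = Vb 0).

Lemma averaged_increment a θ : 0 <= a -> 0 <= θ <= s0 ->
  Rabs (V (a + θ) - V a - fbar (eps * V a) (eps * a) * θ) <= 4 + 4 * M.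
Proof using Hf Hbar Heps Hs0 Hsmall HVc HVd.
intros Ha Hθ; assert (Hκ := drift_lip_pos _ _ _ Hf).
assert (HM : 0 <= M) by (eapply Rle_trans; [apply Rabs_pos|apply (drift_bound _ _ _ Hf 0 0 0 0)]).
destruct (frozen_sol_exists f κ M (eps * V a) (eps * a) Hf) as [W HW].
assert (Hrot : forall s, 0 <= s -> _) by
  exact (fun s => rotation_error f κ M fbar _ _ W s Hf Hbar HW).
assert (H1 := Hrot a Ha); assert (H2 := Hrot (a + θ) (Rplus_le_le_0_compat _ _ Ha (proj1 Hθ))).
destruct HW as [_ [HWc HWd]].
destruct (integer_part (V a - W a)) as [m Hm].
(* Over one step the slow value moves by at most [eps * M * s0] and the slow time by [eps * s0]. *)
set (d := eps * ((M + 1) * s0)).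
assert (Hd : 0 <= d) by (apply Rmult_le_pos; [lra|apply Rmult_le_pos; lra]).
assert (Hclose : forall t, a < t <= a + θ ->
  Rabs (eps * V t - eps * V a) + Rabs (eps * t - eps * a) <= d).
{ intros t Ht; rewrite <- !Rmult_minus_distr_l, !Rabs_mult, (Rabs_right eps) by lra.
  rewrite (Rabs_right (t - a)) by lra.
  assert (HVt : Rabs (V t - V a) <= M * (t - a)).
  { apply (increment_bound V (fun t => f (V t) t (eps * V t) (eps * t))); [lra|exact HVc|].
    intros s Hs; split; [apply HVd; lra|apply (drift_bound _ _ _ Hf)]. }
  rewrite <- Rmult_plus_distr_l; unfold d; apply Rmult_le_compat_l; [lra|].
  assert ((M + 1) * (t - a) <= (M + 1) * s0) by (apply Rmult_le_compat_l; lra); lra. }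
assert (Herr : κ * d * (a + θ - a) * exp (κ * (a + θ - a)) <= 1).
{ replace (a + θ - a) with θ by ring.
  apply Rle_trans with (2 := Hsmall); fold d.
  replace (κ * d * θ * exp (κ * θ)) with (d * (κ * θ * exp (κ * θ))) by ring.
  apply Rmult_le_compat_l; [exact Hd|].
  assert (κ * θ <= κ * s0) by (apply Rmult_le_compat_l; lra).
  apply Rmult_le_compat; [apply Rmult_le_pos; lra|apply Rlt_le, exp_pos|assumption|].
  apply exp_le; assumption. }
assert (Hup := drift_comparison f κ M V W (fun t => eps * V t) (fun t => eps * t)
  (fun _ => eps * V a) (fun _ => eps * a) a (a + θ) d (m + 1) Hf).
assert (Hlo := drift_comparison f κ M W V (fun _ => eps * V a) (fun _ => eps * a)
  (fun t => eps * V t) (fun t => eps * t) a (a + θ) d (- m) Hf).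
assert (HVd' : forall t, a < t <= a + θ -> is_derive V t (f (V t) t (eps * V t) (eps * t)))
  by (intros; apply HVd; lra).
assert (HWd' : forall t, a < t <= a + θ -> is_derive W t (f (W t) t (eps * V a) (eps * a)))
  by (intros; apply HWd; lra).
rewrite plus_IZR in Hup; rewrite opp_IZR in Hlo.
assert (Hup' : V (a + θ) <= W (a + θ) + (IZR m + 1) +
  κ * d * (a + θ - a) * exp (κ * (a + θ - a)))
  by (apply Hup; try assumption; lra).
assert (Hlo' : W (a + θ) <= V (a + θ) + - IZR m +
  κ * d * (a + θ - a) * exp (κ * (a + θ - a))).
{ apply Hlo; try assumption; try lra.
  intros t Ht; rewrite (Rabs_minus_sym (eps * V a)), (Rabs_minus_sym (eps * a)).
  apply Hclose, Ht. }
apply Rabs_le_between in H1; apply Rabs_le_between in H2.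
apply Rabs_le; lra.
Qed.

(* The affine interpolant [Y] of the averaged motion solves the effective equation
   up to [1 / s0], so by monotonicity its distance to [Vb] grows by at most 1. *)
Lemma one_step_error a θ : 0 <= a -> 0 <= θ <= s0 ->
  Rabs (V (a + θ) - Vb (a + θ)) <= Rabs (V a - Vb a) + (5 + 4 * M).
Proof using Hf Hbar Heps Hs0 Hsmall HVc HVd HVbc HVbd.
intros Ha Hθ; assert (Hκ := drift_lip_pos _ _ _ Hf).
assert (HM : 0 <= M) by (eapply Rle_trans; [apply Rabs_pos|apply (drift_bound _ _ _ Hf 0 0 0 0)]).
assert (Havg := averaged_increment a θ Ha Hθ).
set (φ := fbar (eps * V a) (eps * a)) in *.
set (Y := fun t => V a + φ * (t - a)).
assert (HYc : forall t, continuous Y t).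
{ intros t; apply (ex_derive_continuous Y); unfold Y; auto_derive; trivial. }
assert (HYd : forall t, is_derive Y t φ).
{ intros t; unfold Y; auto_derive; trivial; ring. }
assert (Hφ : forall t, a < t <= a + θ ->
  Rabs (φ - fbar (eps * Y t) (eps * t)) <= 1 / s0).
{ intros t Ht; apply (drift_modulus f κ M); try assumption.
  apply Rle_trans with (2 := Hsmall); apply Rmult_le_compat_r.
  { apply Rmult_le_pos; [apply Rmult_le_pos; lra|apply Rlt_le, exp_pos]. }
  replace (eps * V a - eps * Y t) with (eps * - (φ * (t - a))) by (unfold Y; ring).
  rewrite <- Rmult_minus_distr_l, !Rabs_mult, Rabs_Ropp, (Rabs_right eps) by lra.
  rewrite Rabs_mult, (Rabs_minus_sym a), (Rabs_right (t - a)) by lra.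
  assert (Hb := effective_drift_bound f κ M fbar (eps * V a) (eps * a) Hf Hbar); fold φ in Hb.
  rewrite <- Rmult_plus_distr_l; apply Rmult_le_compat_l; [lra|].
  assert (Rabs φ * (t - a) <= M * s0) by (apply Rmult_le_compat; try lra; apply Rabs_pos).
  lra. }
assert (Hmono : forall x y t, x <= y -> fbar (eps * y) (eps * t) <= fbar (eps * x) (eps * t)).
{ intros x y t Hxy; apply (effective_drift_noninc f κ M); try assumption.
  apply Rmult_le_compat_l; lra. }
assert (Hs0' : 0 < 1 / s0) by (apply Rdiv_lt_0_compat; lra).
assert (Hθ1 : 1 / s0 * θ <= 1).
{ apply Rle_trans with (1 / s0 * s0); [apply Rmult_le_compat_l; lra|right; field; lra]. }
assert (HA := Rabs_pos (V a - Vb a)).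
assert (HYa : Y a = V a) by (unfold Y; ring).
assert (HYb : Y (a + θ) = V a + φ * θ) by (unfold Y; ring).
assert (H1 : Y (a + θ) - Vb (a + θ) <=
  (Rabs (V a - Vb a) + 1 / s0 * (a + θ - a)) * exp (0 * (a + θ - a))).
{ apply (one_sided_gronwall (fun t => Y t - Vb t)); try lra.
  - intros t _; apply (continuous_minus Y Vb); [apply HYc|apply HVbc].
  - intros t Ht Hpos; exists (φ - fbar (eps * Vb t) (eps * t)); split.
    + apply (is_derive_minus Y Vb); [apply HYd|apply HVbd; lra].
    + assert (H := Hmono (Vb t) (Y t) t); specialize (Hφ t Ht).
      apply Rabs_le_between in Hφ; lra.
  - rewrite HYa; apply Rle_abs. }
assert (H2 : Vb (a + θ) - Y (a + θ) <=
  (Rabs (V a - Vb a) + 1 / s0 * (a + θ - a)) * exp (0 * (a + θ - a))).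
{ apply (one_sided_gronwall (fun t => Vb t - Y t)); try lra.
  - intros t _; apply (continuous_minus Vb Y); [apply HVbc|apply HYc].
  - intros t Ht Hpos; exists (fbar (eps * Vb t) (eps * t) - φ); split.
    + apply (is_derive_minus Vb Y); [apply HVbd; lra|apply HYd].
    + assert (H := Hmono (Y t) (Vb t) t); specialize (Hφ t Ht).
      apply Rabs_le_between in Hφ; lra.
  - rewrite HYa, Rabs_minus_sym; apply Rle_abs. }
rewrite Rmult_0_l, exp_0, Rmult_1_r in H1, H2.
replace (a + θ - a) with θ in H1, H2 by ring.
(* [4 + 4 * M] comes from the distance of [V] to [Y], and 1 from the growth of the distance of [Y]
   to [Vb]. *)
apply Rabs_le_between in Havg; apply Rabs_le; lra.
Qed.

(** Step errors add up without amplification; the [+ 1] comes from rounding the number of steps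
    up. *)
Lemma fast_scale_error s : 0 <= s -> Rabs (V s - Vb s) <= (s / s0 + 1) * (5 + 4 * M).
Proof using Hf Hbar Heps Hs0 Hsmall HVc HVd HVbc HVbd HV0.
intros Hs.
assert (HM : 0 <= M) by (eapply Rle_trans; [apply Rabs_pos|apply (drift_bound _ _ _ Hf 0 0 0 0)]).
assert (Hind : forall (k : nat) s, 0 <= s <= INR k * s0 ->
  Rabs (V s - Vb s) <= INR k * (5 + 4 * M)).
{ induction k as [|k IH]; intros t Ht.
  - simpl in Ht; replace t with 0 by lra; rewrite HV0, Rminus_diag, Rabs_R0; simpl; lra.
  - rewrite S_INR in *.
    assert (Hk : 0 <= INR k * s0) by (apply Rmult_le_pos; [apply pos_INR|lra]).
    (* The last step starts [s0] before [t], or at 0 if [t] is smaller than [s0]. *)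
    set (a := Rmax 0 (t - s0)).
    assert (Ha : 0 <= a <= INR k * s0) by (split; [apply Rmax_l|apply Rmax_lub; lra]).
    assert (Hat : 0 <= t - a <= s0) by (unfold a, Rmax; destruct Rle_dec; lra).
    assert (H := one_step_error a (t - a) (proj1 Ha) Hat).
    replace (a + (t - a)) with t in H by ring.
    specialize (IH a Ha); lra. }
assert (Hq : 0 <= s / s0) by (apply Rmult_le_pos; [assumption|apply Rlt_le, Rinv_0_lt_compat, Hs0]).
destruct (nat_part (s / s0) Hq) as [k Hk].
apply Rle_trans with (INR (S k) * (5 + 4 * M)).
- apply Hind; split; [exact Hs|rewrite S_INR].
  apply Rle_trans with (s / s0 * s0); [right; field; lra|apply Rmult_le_compat_r; lra].
- apply Rmult_le_compat_r; [lra|rewrite S_INR; lra].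
Qed.

End FastScale.

(** * Return to the original time, and choice of the step length *)

Lemma rescaled_sol (g : R -> R -> R) eps c u :
  0 < eps -> global_sol g c u ->
  global_sol (fun x s => g (eps * x) (eps * s)) (c / eps) (fun s => u (eps * s) / eps).
Proof.
intros Heps [H0 [Hc Hd]]; split; [rewrite Rmult_0_r, H0; reflexivity|split].
- intros t; apply (continuous_mult (fun s => u (eps * s)) (fun _ => / eps)); [|apply continuous_const].
  apply (continuous_comp (fun s => eps * s) u); [|apply Hc].
  apply (ex_derive_continuous (fun s => eps * s)); auto_derive; trivial.
- intros t Ht.
  assert (Het : 0 < eps * t) by (apply Rmult_lt_0_compat; assumption).
  replace (eps * (u (eps * t) / eps)) with (u (eps * t)) by (field; lra).
  apply (is_derive_ext (fun s => / eps * u (eps * s)));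
    [intros s; unfold Rdiv; apply Rmult_comm|].
  replace (g (u (eps * t)) (eps * t)) with (/ eps * (eps * g (u (eps * t)) (eps * t)))
    by (field; lra).
  apply (is_derive_scal (fun s => u (eps * s))).
  apply (is_derive_comp u (fun s => eps * s)); [apply Hd, Het|].
  auto_derive; trivial; ring.
Qed.

(** Apply [fast_scale_error] at time [t / eps] to the rescaled solutions and multiply by [eps]: the
    number of steps [t / (eps * s0) + 1] becomes [t / s0 + eps]. *)
Lemma homogenization_error f κ M fbar c ub ue eps s0 t :
  periodic_drift f κ M -> effective_drift f fbar -> 0 < eps -> 0 < s0 ->
  eps * ((M + 1) * s0) * (κ * s0 * exp (κ * s0)) <= 1 ->
  global_sol fbar c ub ->
  global_sol (fun x s => f (x / eps) (s / eps) x s) c ue ->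
  0 <= t -> Rabs (ue t - ub t) <= (t / s0 + eps) * (5 + 4 * M).
Proof.
intros Hf Hbar Heps Hs0 Hsmall Hub Hue Ht.
destruct (rescaled_sol _ eps c ub Heps Hub) as [Hb0 [Hbc Hbd]].
destruct (rescaled_sol _ eps c ue Heps Hue) as [He0 [Hec Hed]].
assert (H := fast_scale_error f κ M eps s0 fbar (fun s => ue (eps * s) / eps)
  (fun s => ub (eps * s) / eps) Hf Hbar Heps Hs0 Hsmall Hec Hbc).
assert (Hfast : forall s, 0 <= s ->
  Rabs (ue (eps * s) / eps - ub (eps * s) / eps) <= (s / s0 + 1) * (5 + 4 * M)).
{ apply H; [|exact Hbd|congruence].
  intros s Hs; specialize (Hed s Hs).
  replace (f (ue (eps * s) / eps) s (eps * (ue (eps * s) / eps)) (eps * s))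
    with (f (eps * (ue (eps * s) / eps) / eps) (eps * s / eps)
      (eps * (ue (eps * s) / eps)) (eps * s)); [exact Hed|].
  f_equal; field; lra. }
specialize (Hfast (t / eps)).
replace (eps * (t / eps)) with t in Hfast by (field; lra).
replace (ue t - ub t) with (eps * (ue t / eps - ub t / eps)) by (field; lra).
rewrite Rabs_mult, (Rabs_right eps) by lra.
apply Rle_trans with (eps * ((t / eps / s0 + 1) * (5 + 4 * M))).
- apply Rmult_le_compat_l; [lra|]; apply Hfast.
  apply Rmult_le_pos; [assumption|apply Rlt_le, Rinv_0_lt_compat, Heps].
- right; field; lra.
Qed.

(* Steps of fast time [log_step P * |ln eps|] are short enough for the Gronwall factor
   [exp (P * s0)] to be at most [eps^(-1/2)], and [l^2 exp (- l / 2) <= 16] does the rest. *)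
Definition log_step (P : R) : R := / (8 * (P + 1) ^ 2).

Lemma log_step_small (P eps : R) :
  0 < P -> 0 < eps < 1 ->
  let s0 := log_step P * Rabs (ln eps) in
  0 < s0 /\ eps * ((P + 1) * s0) * (P * s0 * exp (P * s0)) <= 1.
Proof.
intros HP Heps s0.
assert (Hln : ln eps < 0) by (rewrite <- ln_1; apply ln_increasing; lra).
set (l := Rabs (ln eps)) in *.
assert (Hl : l = - ln eps) by (apply Rabs_left, Hln).
assert (Hη : 0 < log_step P) by (apply Rinv_0_lt_compat; nra).
assert (Hη1 : log_step P * (8 * (P + 1) ^ 2) = 1) by (apply Rinv_l; nra).
set (η := log_step P) in *.
assert (Hs0 : 0 < s0) by (apply Rmult_lt_0_compat; lra).
split; [exact Hs0|].
assert (HPη : 8 * (P * η) <= 1) by nra.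
assert (HPη2 : 16 * (P * (P + 1) * (η * η)) <= 1).
{ assert (0 < η * (P + 1)) by (apply Rmult_lt_0_compat; lra). nra. }
assert (Hexp1 : eps * exp (P * s0) <= exp (- (l / 2))).
{ replace eps with (exp (- l)) at 1 by (rewrite Hl, Ropp_involutive; apply exp_ln; lra).
  rewrite <- exp_plus; apply exp_le; unfold s0; nra. }
(* Squaring [exp (l / 4) >= 1 + l / 4] gives [exp (l / 2) >= l^2 / 16]. *)
assert (Hexp2 : l * l * exp (- (l / 2)) <= 16).
{ assert (Hq : 1 + l / 4 <= exp (l / 4)) by (apply exp_ineq1_le).
  assert (Hhalf : exp (l / 2) = exp (l / 4) * exp (l / 4))
    by (rewrite <- exp_plus; f_equal; field).
  assert (Hinv : exp (l / 2) * exp (- (l / 2)) = 1)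
    by (rewrite <- exp_plus, Rplus_opp_r; apply exp_0).
  assert (l * l <= 16 * exp (l / 2)) by (rewrite Hhalf; nra).
  assert (0 < exp (- (l / 2))) by apply exp_pos; nra. }
replace (eps * ((P + 1) * s0) * (P * s0 * exp (P * s0)))
  with (P * (P + 1) * (η * η) * (l * l * (eps * exp (P * s0)))) by (unfold s0; ring).
apply Rle_trans with (P * (P + 1) * (η * η) * 16); [|lra].
apply Rmult_le_compat_l; [apply Rmult_le_pos; [|nra]; nra|].
apply Rle_trans with (2 := Hexp2); apply Rmult_le_compat_l; nra.
Qed.

(** * The norms of [f] as bounds, and displacement of solutions *)

Lemma sup_norm4_ub f M r τ u t :
  (forall r τ u t, Rabs (f r τ u t) <= M) -> Rabs (f r τ u t) <= sup_norm4 f.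
Proof.
intros HM; apply (real_Lub_ub _ M); [|exists r, τ, u, t; reflexivity].
intros y [r' [τ' [u' [t' ->]]]]; apply HM.
Qed.

Lemma lip_quotient_le f κ :
  (forall r τ u t r' τ' u' t',
     Rabs (f r τ u t - f r' τ' u' t') <= κ * dist4 r τ u t r' τ' u' t') ->
  forall y, (exists r τ u t r' τ' u' t', dist4 r τ u t r' τ' u' t' <> 0 /\
     y = Rabs (f r τ u t - f r' τ' u' t') / dist4 r τ u t r' τ' u' t') -> y <= κ.
Proof.
intros Hlip y (r & τ & u & t & r' & τ' & u' & t' & Hd & ->).
assert (Hd0 : 0 < dist4 r τ u t r' τ' u' t').
{ destruct (sqrt_pos ((r - r')^2 + (τ - τ')^2 + (u - u')^2 + (t - t')^2)) as [H|H];
    [exact H|exfalso; apply Hd; symmetry; exact H]. }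
apply Rmult_le_reg_r with (1 := Hd0).
unfold Rdiv; rewrite Rmult_assoc, Rinv_l, Rmult_1_r by exact Hd; apply Hlip.
Qed.

(** Pairs at distance 0 are absent from the supremum; for them the assumed bound with [κ] forces
    equal values. *)
Lemma lip_norm4_ub f κ r τ u t r' τ' u' t' :
  (forall r τ u t r' τ' u' t',
     Rabs (f r τ u t - f r' τ' u' t') <= κ * dist4 r τ u t r' τ' u' t') ->
  Rabs (f r τ u t - f r' τ' u' t') <= lip_norm4 f * dist4 r τ u t r' τ' u' t'.
Proof.
intros Hlip.
destruct (Req_dec (dist4 r τ u t r' τ' u' t') 0) as [H0|H0].
- rewrite H0, Rmult_0_r, <- (Rmult_0_r κ), <- H0; apply Hlip.
- assert (Hd0 : 0 <= dist4 r τ u t r' τ' u' t') by apply sqrt_pos.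
  assert (Hq : Rabs (f r τ u t - f r' τ' u' t') / dist4 r τ u t r' τ' u' t' <= lip_norm4 f).
  { apply (real_Lub_ub _ κ); [apply lip_quotient_le, Hlip|].
    exists r, τ, u, t, r', τ', u', t'; split; [exact H0|reflexivity]. }
  apply Rmult_le_compat_r with (r := dist4 r τ u t r' τ' u' t') in Hq; [|exact Hd0].
  unfold Rdiv in Hq; rewrite Rmult_assoc, Rinv_l, Rmult_1_r in Hq by exact H0; exact Hq.
Qed.

Lemma lip_norm4_nonneg f κ :
  (forall r τ u t r' τ' u' t',
     Rabs (f r τ u t - f r' τ' u' t') <= κ * dist4 r τ u t r' τ' u' t') ->
  0 <= lip_norm4 f.
Proof.
intros Hlip; assert (H := lip_norm4_ub f κ 1 0 0 0 0 0 0 0 Hlip).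
assert (H0 := Rabs_pos (f 1 0 0 0 - f 0 0 0 0)).
assert (Hd : dist4 1 0 0 0 0 0 0 0 = 1).
{ rewrite <- sqrt_1 at 2; unfold dist4; f_equal; ring. }
rewrite Hd in H; lra.
Qed.

Lemma sol_displacement (g : R -> R -> R) c u M t :
  global_sol g c u -> (forall x s, Rabs (g x s) <= M) -> 0 <= t -> Rabs (u t - c) <= M * t.
Proof.
intros [H0 [Hc Hd]] HM Ht.
rewrite <- H0; replace (M * t) with (M * (t - 0)) by ring.
apply (increment_bound u (fun t => g (u t) t)); [exact Ht|exact Hc|].
intros s Hs; split; [apply Hd; lra|apply HM].
Qed.

(** * Derivation of the three claims, with constants depending only on the norm *)

Theorem theorem1p2 :
  exists Phi : R -> R, (forall N, 0 < Phi N) /\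
  forall (f : R -> R -> R -> R -> R) (κ : R) (fbar : R -> R -> R),
    0 < κ ->
    (exists M, forall r τ u t, Rabs (f r τ u t) <= M) ->
    (forall r τ u t r' τ' u' t',
        Rabs (f r τ u t - f r' τ' u' t') <= κ * dist4 r τ u t r' τ' u' t') ->
    (forall r τ u t, f (r + 1) τ u t = f r τ u t) ->
    (forall r τ u t, f r (τ + 1) u t = f r τ u t) ->
    (forall r τ u u' t, u <= u' -> f r τ u' t <= f r τ u t) ->
    (* defining property of fbar *)
    (forall u0 t0 c t (ue : R -> R -> R),
        0 < t ->
        (forall eps, 0 < eps ->
           ode_sol (fun x s => f (x / eps) (s / eps) u0 t0) c (ue eps)) ->
        filterlim (fun eps => ue eps t) (at_right 0)
                  (locally (c + fbar u0 t0 * t))) ->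
    (* (i) *)
    (forall u1 t1 u2 t2, 0 < t1 -> 0 < t2 ->
       (Rabs (u1 - u2) + Rabs (t1 - t2) = 0 -> fbar u1 t1 = fbar u2 t2) /\
       (0 < Rabs (u1 - u2) + Rabs (t1 - t2) ->
        0 < Rfloor (LambertW (1 / (Rabs (u1 - u2) + Rabs (t1 - t2))) / κ) ->
        Rabs (fbar u1 t1 - fbar u2 t2) <=
          2 / Rfloor (LambertW (1 / (Rabs (u1 - u2) + Rabs (t1 - t2))) / κ)))
    /\
    (* (ii) *)
    (forall c, exists ub, ode_sol fbar c ub /\
        forall v, ode_sol fbar c v -> forall t, 0 <= t -> v t = ub t)
    /\
    (* (iii), with C = Phi (||f||_{W^{1,oo}}) *)
    (forall c ub, ode_sol fbar c ub ->
     forall eps ue, 0 < eps < 1 ->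
       ode_sol (fun x s => f (x / eps) (s / eps) x s) c ue ->
       (forall t, eps * Rabs (ln eps) < t ->
          Rabs (ue t - ub t) <= Phi (W1inf_norm4 f) * t / Rabs (ln eps)) /\
       (forall t, 0 <= t <= eps * Rabs (ln eps) ->
          Rabs (ue t - ub t) <=
            Rmin (Phi (W1inf_norm4 f) * eps) (2 * sup_norm4 f * t))).
Proof.
(* [8 * (P + 1) ^ 2] is the inverse of [log_step P], the [+ 1] absorbs the term [eps], and
   [5 + 4 * P] is the error per step. *)
set (C := fun P => (8 * (P + 1) ^ 2 + 1) * (5 + 4 * P)).
(* The absolute value makes [Phi] positive for every real [N]; adding 1 keeps the Lipschitz constant
   positive even for constant [f]. *)
exists (fun N => C (Rabs N + 1)); split.
{ intros N; assert (H := Rabs_pos N); unfold C.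
  apply Rmult_lt_0_compat; nra. }
intros f κ fbar Hκ [M HM] Hlip Hr Hτ Hmono Hbar.
change (effective_drift f fbar) in Hbar.
(* Stated for arbitrary constants: (i) and (ii) use [κ], while (iii) uses a constant read off from
   the norm. *)
assert (Hper : forall k B, 0 < k ->
  (forall r τ u t, Rabs (f r τ u t) <= B) ->
  (forall r τ u t r' τ' u' t',
     Rabs (f r τ u t - f r' τ' u' t') <= k * dist4 r τ u t r' τ' u' t') ->
  periodic_drift f k B).
{ intros k B Hk HB Hkl; constructor; try assumption.
  intros; eapply Rle_trans; [apply Hkl|].
  apply Rmult_le_compat_l; [lra|apply dist4_le]. }
assert (Hsup : forall r τ u t, Rabs (f r τ u t) <= sup_norm4 f)
  by (intros; apply (sup_norm4_ub f M); exact HM).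
assert (Hf := Hper κ (sup_norm4 f) Hκ Hsup Hlip).
split; [|split].
- intros u1 t1 u2 t2 _ _; split.
  + intros Hd.
    assert (H1 := Rabs_pos (u1 - u2)); assert (H2 := Rabs_pos (t1 - t2)).
    assert (Hu : u1 = u2) by (destruct (Req_dec (u1 - u2) 0) as [|Hne];
      [lra|apply Rabs_pos_lt in Hne; lra]).
    assert (Ht : t1 = t2) by (destruct (Req_dec (t1 - t2) 0) as [|Hne];
      [lra|apply Rabs_pos_lt in Hne; lra]).
    rewrite Hu, Ht; reflexivity.
  + set (d := Rabs (u1 - u2) + Rabs (t1 - t2)); intros Hd Hn.
    (* The floor itself serves as the step length [s0]; [κ * n <= W (1 / d)] is exactly what makes
       the Gronwall gain at most 1. *)
    set (n := Rfloor (LambertW (1 / d) / κ)) in *.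
    assert (HnW : n <= LambertW (1 / d) / κ) by apply base_Int_part.
    assert (Hκn : κ * n <= LambertW (1 / d)).
    { apply Rmult_le_compat_l with (r := κ) in HnW; [|lra].
      replace (κ * (LambertW (1 / d) / κ)) with (LambertW (1 / d)) in HnW by (field; lra).
      exact HnW. }
    assert (HW : κ * n * exp (κ * n) <= 1 / d).
    { apply LambertW_spec; [apply Rdiv_lt_0_compat; lra|].
      split; [apply Rmult_le_pos; lra|exact Hκn]. }
    apply Rle_trans with (1 / n).
    * apply (drift_modulus f κ (sup_norm4 f)); try assumption; fold d.
      apply Rle_trans with (d * (1 / d)); [apply Rmult_le_compat_l; lra|right; field; lra].
    * apply Rmult_le_compat_r; [apply Rlt_le, Rinv_0_lt_compat, Hn|lra].
- intros c.
  destruct (effective_sol_exists f κ (sup_norm4 f) fbar c Hf Hbar) as [ub Hub].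
  exists ub; split; [apply global_sol_ode_sol, Hub|].
  intros v Hv t Ht.
  destruct (ode_sol_global_sol _ _ _ Hv) as [w [Hw Hvw]]; rewrite (Hvw t Ht).
  assert (Hg : forall x y t, x <= y -> fbar y t <= fbar x t)
    by (intros; apply (effective_drift_noninc f κ (sup_norm4 f)); assumption).
  apply Rle_antisym; apply (noninc_sol_le fbar c); assumption.
- intros c ub Hub eps ue Heps Hue.
  destruct (ode_sol_global_sol _ _ _ Hub) as [vb [Hvb Hub']].
  destruct (ode_sol_global_sol _ _ _ Hue) as [ve [Hve Hue']].
  set (N := W1inf_norm4 f); set (P := Rabs N + 1).
  assert (Hsup0 : 0 <= sup_norm4 f) by (eapply Rle_trans; [apply Rabs_pos|apply (Hsup 0 0 0 0)]).
  assert (Hlip0 := lip_norm4_nonneg f κ Hlip).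
  assert (HP : P = sup_norm4 f + lip_norm4 f + 1)
    by (unfold P, N, W1inf_norm4; rewrite Rabs_right; lra).
  (* [P] bounds both the supremum and the Lipschitz constant of [f]. *)
  assert (HfP : periodic_drift f P P).
  { apply Hper; [lra|intros; eapply Rle_trans; [apply Hsup|lra]|].
    intros; eapply Rle_trans; [apply (lip_norm4_ub f κ); exact Hlip|].
    apply Rmult_le_compat_r; [apply sqrt_pos|lra]. }
  destruct (log_step_small P eps) as [Hs0 Hsmall]; [lra|exact Heps|].
  set (l := Rabs (ln eps)) in *.
  assert (Hl : 0 < l).
  { apply Rabs_pos_lt; assert (ln eps < 0) by (rewrite <- ln_1; apply ln_increasing; lra); lra. }
  assert (Herr : forall t, 0 <= t ->
    Rabs (ue t - ub t) <= (8 * (P + 1) ^ 2 * (t / l) + eps) * (5 + 4 * P)).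
  { intros t Ht; rewrite (Hue' t Ht), (Hub' t Ht).
    replace (8 * (P + 1) ^ 2 * (t / l)) with (t / (log_step P * l))
      by (unfold log_step; field; split; nra).
    apply (homogenization_error f P P fbar c); try assumption; lra. }
  assert (HCP : forall t, t = (t / l) * l) by (intros; field; lra).
  split.
  + intros t Ht.
    assert (Ht0 : 0 <= t) by (assert (0 < eps * l) by (apply Rmult_lt_0_compat; lra); lra).
    eapply Rle_trans; [apply (Herr t Ht0)|]; unfold C; fold P.
    replace ((8 * (P + 1) ^ 2 + 1) * (5 + 4 * P) * t / l)
      with ((8 * (P + 1) ^ 2 * (t / l) + t / l) * (5 + 4 * P)) by (field; lra).
    apply Rmult_le_compat_r; [lra|].
    (* Beyond the initial layer [t > eps * l], the term [eps] is absorbed by [t / l]; inside the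
       layer the roles are exchanged. *)
    assert (eps <= t / l); [|lra].
    apply Rmult_le_reg_r with l; [exact Hl|rewrite <- HCP; lra].
  + intros t [Ht0 Ht]; apply Rmin_glb.
    * eapply Rle_trans; [apply (Herr t Ht0)|]; unfold C; fold P.
      replace ((8 * (P + 1) ^ 2 + 1) * (5 + 4 * P) * eps)
        with ((8 * (P + 1) ^ 2 * eps + eps) * (5 + 4 * P)) by ring.
      apply Rmult_le_compat_r; [lra|].
      apply Rplus_le_compat_r, Rmult_le_compat_l; [nra|].
      apply Rmult_le_reg_r with l; [exact Hl|rewrite <- HCP; lra].
    * rewrite (Hue' t Ht0), (Hub' t Ht0).
      (* Both solutions start at [c] with speed at most the supremum of [f], which gives the factor
         2. *)
      assert (H1 := sol_displacement _ c ve (sup_norm4 f) t Hve (fun x s => Hsup _ _ _ _) Ht0).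
      assert (H2 := sol_displacement _ c vb (sup_norm4 f) t Hvb
        (fun x s => effective_drift_bound f κ _ fbar x s Hf Hbar) Ht0).
      apply Rabs_le_between in H1; apply Rabs_le_between in H2; apply Rabs_le; lra.
Qed.
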